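(* Let $A_1,A_2\in\mathbf{C}^{n\times n}$, $B_1,B_2\in\mathbf{C}^{n\times m}$, and assume the system $x^+=A_1x+A_2^{\#}x^{\#}+B_1u+B_2^{\#}u^{\#}$, $x(0)=x_0$ (continuous time $t\in\mathbf{R}^+$, $x^+=\dot x$, or discrete time $t\in\mathbf{Z}^+$, $x^+(t)=x(t+1)$) is stabilizable. Let $\{Q_1,Q_2\}>0$ ($Q_i\in\mathbf{C}^{n\times n}$) and $\{R_1,R_2\}>0$ ($R_i\in\mathbf{C}^{m\times m}$) and consider the cost $$J(u)=\int_0^\infty\mathrm{Re}\big(x^{\mathrm H}\{Q_1,Q_2\}x+u^{\mathrm H}\{R_1,R_2\}u\big)\,\mathrm{d}t\ (t\in\mathbf{R}^+),\qquad J(u)=\sum_{t=0}^\infty\mathrm{Re}\big(x^{\mathrm H}\{Q_1,Q_2\}x+u^{\mathrm H}\{R_1,R_2\}u\big)\ (t\in\mathbf{Z}^+).$$ Then there is a unique bimatrix $\{P_1,P_2\}>0$ ($P_i\in\mathbf{C}^{n\times n}$) solving, for $t\in\mathbf{R}^+$, $$-\{Q_1,Q_2\}=\{A_1,A_2\}^{\mathrm H}\{P_1,P_2\}+\{P_1,P_2\}\{A_1,A_2\}-\{P_1,P_2\}\{B_1,B_2\}\{R_1,R_2\}^{-1}\{B_1,B_2\}^{\mathrm H}\{P_1,P_2\},$$ and, for $t\in\mathbf{Z}^+$, $$-\{Q_1,Q_2\}=\{A_1,A_2\}^{\mathrm H}\{P_1,P_2\}\{A_1,A_2\}-\{P_1,P_2\}-\{A_1,A_2\}^{\mathrm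 H}\{P_1,P_2\}\{B_1,B_2\}\{S_1,S_2\}^{-1}\{B_1,B_2\}^{\mathrm H}\{P_1,P_2\}\{A_1,A_2\},$$ where $\{S_1,S_2\}=\{R_1,R_2\}+\{B_1,B_2\}^{\mathrm H}\{P_1,P_2\}\{B_1,B_2\}$. Moreover, the control minimizing $J$ is the full state feedback $u^*=\{K_1^*,K_2^*\}x$ with $$\{K_1^*,K_2^*\}=-\{R_1,R_2\}^{-1}\{B_1,B_2\}^{\mathrm H}\{P_1,P_2\}\ (t\in\mathbf{R}^+),\qquad \{K_1^*,K_2^*\}=-\{S_1,S_2\}^{-1}\{B_1,B_2\}^{\mathrm H}\{P_1,P_2\}\{A_1,A_2\}\ (t\in\mathbf{Z}^+),$$ the resulting closed-loop system is asymptotically stable, and the minimal cost is $J_{\min}(u^* )=\mathrm{Re}\big(x_0^{\mathrm H}\{P_1,P_2\}x_0\big)$.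
   Context: $P^{\#}$, $P^{\mathrm T}$, $P^{\mathrm H}$: entrywise conjugate, transpose, conjugate transpose. For $A_1,A_2\in\mathbf{C}^{n\times m}$, the bimatrix $\{A_1,A_2\}$ is the real-linear map $x\mapsto A_1x+A_2^{\#}x^{\#}$; equality means equality as maps; sums pointwise, products compositions ($\{A_1,A_2\}\{B_1,B_2\}=\{A_1B_1+A_2^{\#}B_2,A_1^{\#}B_2+A_2B_1\}$), $-\{A_1,A_2\}=\{-A_1,-A_2\}$, identity $\{I,0\}$, inverse = two-sided inverse bimatrix, conjugate transpose $\{A_1,A_2\}^{\mathrm H}=\{A_1^{\mathrm H},A_2^{\mathrm T}\}$. A square bimatrix $\{P_1,P_2\}$ is positive definite ($>0$) if $P_1=P_1^{\mathrm H}$, $P_2=P_2^{\mathrm T}$ and $\mathrm{Re}(x^{\mathrm H}(P_1x+P_2^{\#}x^{\#}))>0$ for all $x\ne0$. The system is stabilizable if some full state feedback $u=K_1x+K_2^{\#}x^{\#}$ makes the closed loop asymptotically stable (equivalently, the real pair $(\{A_1,A_2\}_\circ,\{B_1,B_2\}_\circ)$ is stabilizable, where $\{A_1,A_2\}_\circ=\begin{bmatrix}\mathrm{Re}(A_1+A_2) & -\mathrm{Im}(A_1+A_2)\\ \mathrm{Im}(A_1-A_2) & \mathrm{Re}(A_1-A_2)\end{bmatrix}$). *)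

(* Defs.v *)
From HB Require Import structures.
From Stdlib Require Import ClassicalEpsilon.
From mathcomp Require Import all_boot all_order all_algebra.
From mathcomp Require Import all_classical all_reals all_analysis.
From mathcomp.real_closed Require Import complex.

Set Implicit Arguments.
Unset Strict Implicit.
Unset Printing Implicit Defensive.

Import Order.TTheory GRing.Theory Num.Theory.
Import numFieldNormedType.Exports.
Local Open Scope ring_scope.
Local Open Scope classical_set_scope.

Section Bimatrices.
Variable R : realType.
Local Notation C := (R[i]).

Definition cmx (p q : nat) (A : 'M[C]_(p, q)) : 'M[C]_(p, q) :=
  map_mx (@conjc R) A.
Definition hmx (p q : nat) (A : 'M[C]_(p, q)) : 'M[C]_(q, p) := (cmx A)^T.

Record bimx (p q : nat) := Bimx { bm1 : 'M[C]_(p, q); bm2 : 'M[C]_(p, q) }.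

Definition bapp p q (A : bimx p q) (x : 'cV[C]_q) : 'cV[C]_p :=
  bm1 A *m x + cmx (bm2 A) *m cmx x.

Definition bimx_eq p q (A B : bimx p q) : Prop :=
  forall x, bapp A x = bapp B x.

Definition badd p q (A B : bimx p q) : bimx p q :=
  Bimx (bm1 A + bm1 B) (bm2 A + bm2 B).
Definition bopp p q (A : bimx p q) : bimx p q := Bimx (- bm1 A) (- bm2 A).
Definition bsub p q (A B : bimx p q) : bimx p q := badd A (bopp B).
Definition bmul p q r (A : bimx p q) (B : bimx q r) : bimx p r :=
  Bimx (bm1 A *m bm1 B + cmx (bm2 A) *m bm2 B)
       (cmx (bm1 A) *m bm2 B + bm2 A *m bm1 B).
Definition bH p q (A : bimx p q) : bimx q p := Bimx (hmx (bm1 A)) (bm2 A)^T.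
Definition bid p : bimx p p := Bimx 1%:M 0.

(* two-sided inverse bimatrix, and "the" inverse (chosen; unique when it exists) *)
Definition is_binv p (A S : bimx p p) : Prop :=
  bimx_eq (bmul A S) (bid p) /\ bimx_eq (bmul S A) (bid p).
Definition binv p (A : bimx p p) : bimx p p :=
  epsilon (inhabits (bid p)) (is_binv A).

Definition bqf p (P : bimx p p) (x : 'cV[C]_p) : R :=
  complex.Re ((hmx x *m bapp P x) 0 0).

Definition bpos p (P : bimx p p) : Prop :=
  [/\ bm1 P = hmx (bm1 P), bm2 P = (bm2 P)^T &
      forall x : 'cV[C]_p, x != 0 -> 0 < bqf P x].

Local Notation mu := (@lebesgue_measure R).

Definition loc_integrable (f : R -> R) : Prop :=
  forall t : R, 0 <= t -> mu.-integrable `[0, t] (EFin \o f).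

(* x(t) = x0 + \int_0^t v(s) ds for all t >= 0 (componentwise, real and
   imaginary parts), with v locally integrable: the (Caratheodory) solution
   notion for x' = v, x(0) = x0. *)
Definition ct_integral_eq p (x0 : 'cV[C]_p) (x v : R -> 'cV[C]_p) : Prop :=
  forall i : 'I_p,
    [/\ loc_integrable (fun s => complex.Re (v s i 0)),
        loc_integrable (fun s => complex.Im (v s i 0)),
        forall t : R, 0 <= t ->
          complex.Re (x t i 0) = complex.Re (x0 i 0) + \int[mu]_(s in `[0, t]) complex.Re (v s i 0)
      & forall t : R, 0 <= t ->
          complex.Im (x t i 0) = complex.Im (x0 i 0) + \int[mu]_(s in `[0, t]) complex.Im (v s i 0)].

Definition ct_admissible n m (A : bimx n n) (B : bimx n m) (x0 : 'cV[C]_n)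
    (x : R -> 'cV[C]_n) (u : R -> 'cV[C]_m) : Prop :=
  (forall j : 'I_m, loc_integrable (fun s => complex.Re (u s j 0)) /\
                    loc_integrable (fun s => complex.Im (u s j 0))) /\
  ct_integral_eq x0 x (fun s => bapp A (x s) + bapp B (u s)).

Definition ct_cost n m (Q : bimx n n) (Rw : bimx m m)
    (x : R -> 'cV[C]_n) (u : R -> 'cV[C]_m) : \bar R :=
  (\int[mu]_(t in `[0%R, +oo[) (bqf Q (x t) + bqf Rw (u t))%:E)%E.

Definition ct_asym_stable n (F : bimx n n) : Prop :=
  forall (x0 : 'cV[C]_n) (x : R -> 'cV[C]_n),
    ct_integral_eq x0 x (fun s => bapp F (x s)) ->
    forall i : 'I_n, (complex.Re (x t i 0) @[t --> +oo] --> (0 : R)) /\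
                     (complex.Im (x t i 0) @[t --> +oo] --> (0 : R)).

Definition ct_stabilizable n m (A : bimx n n) (B : bimx n m) : Prop :=
  exists K : bimx m n, ct_asym_stable (badd A (bmul B K)).

Definition ct_riccati n m (A : bimx n n) (B : bimx n m) (Q : bimx n n)
    (Rw : bimx m m) (P : bimx n n) : Prop :=
  bimx_eq (bopp Q)
    (bsub (badd (bmul (bH A) P) (bmul P A))
          (bmul (bmul (bmul P B) (binv Rw)) (bmul (bH B) P))).

Definition ct_gain n m (B : bimx n m) (Rw : bimx m m) (P : bimx n n)
  : bimx m n := bopp (bmul (bmul (binv Rw) (bH B)) P).

Fixpoint dt_traj n m (A : bimx n n) (B : bimx n m) (x0 : 'cV[C]_n)
    (u : nat -> 'cV[C]_m) (t : nat) : 'cV[C]_n :=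
  match t with
  | 0%N => x0
  | t'.+1 => bapp A (dt_traj A B x0 u t') + bapp B (u t')
  end.

Definition dt_cost n m (Q : bimx n n) (Rw : bimx m m)
    (x : nat -> 'cV[C]_n) (u : nat -> 'cV[C]_m) : \bar R :=
  (\sum_(0 <= t <oo) (bqf Q (x t) + bqf Rw (u t))%:E)%E.

Definition dt_asym_stable n (F : bimx n n) : Prop :=
  forall (x0 : 'cV[C]_n) (i : 'I_n),
    (complex.Re (iter t (bapp F) x0 i 0) @[t --> \oo] --> (0 : R)) /\
    (complex.Im (iter t (bapp F) x0 i 0) @[t --> \oo] --> (0 : R)).

Definition dt_stabilizable n m (A : bimx n n) (B : bimx n m) : Prop :=
  exists K : bimx m n, dt_asym_stable (badd A (bmul B K)).

Definition dt_S n m (B : bimx n m) (Rw : bimx m m) (P : bimx n n) : bimx m m :=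
  badd Rw (bmul (bmul (bH B) P) B).

Definition dt_riccati n m (A : bimx n n) (B : bimx n m) (Q : bimx n n)
    (Rw : bimx m m) (P : bimx n n) : Prop :=
  bimx_eq (bopp Q)
    (bsub (bsub (bmul (bmul (bH A) P) A) P)
          (bmul (bmul (bmul (bmul (bH A) P) B) (binv (dt_S B Rw P)))
                (bmul (bmul (bH B) P) A))).

Definition dt_gain n m (A : bimx n n) (B : bimx n m) (Rw : bimx m m)
    (P : bimx n n) : bimx m n :=
  bopp (bmul (bmul (binv (dt_S B Rw P)) (bH B)) (bmul P A)).

End Bimatrices.

(* Main.v *)
Require Import Defs.
From HB Require Import structures.
From Stdlib Require Import ClassicalEpsilon.
From mathcomp Require Import all_boot all_order all_algebra.
From mathcomp Require Import all_classical all_reals all_analysis.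
From mathcomp.real_closed Require Import complex.
From mathcomp Require Import measurable_realfun ring lra.
Import Order.TTheory GRing.Theory Num.Theory.
Import numFieldNormedType.Exports.
Local Open Scope ring_scope.

Set Implicit Arguments.
Unset Strict Implicit.
Unset Printing Implicit Defensive.

(** Bimatrices are the real-linear maps of C^n, so everything is transported to
    real matrices of twice the size, with [bH] becoming transposition. Both time
    axes are treated at once through [lyap h F P = F'P + PF + h F'PF]: [h = 0]
    is continuous time, and [h = 1] with [F = A - 1] is discrete time.

    Stability of [F] is encoded order-theoretically ([lyap h F P <= 0] implies
    [P >= 0] for symmetric [P]); it follows from asymptotic stability because
    the form of [P] is monotone along trajectories tending to 0, and from the
    existence of a strict Lyapunov matrix. It makes the Lyapunov equation
    solvable, so Kleinman's policy iteration produces a decreasing sequence of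
    positive semidefinite matrices, whose limit solves the Riccati equation.

    Completing the square gives (cost up to T) = V(x_0) - V(x(T)) + (weighted
    square of u - K x up to T), with V the form of [P]. A finite cost forces V(x)
    to be arbitrarily small at late times, whence optimality, the value, and the
    essential uniqueness of the optimal control. In continuous time this needs
    the product rule for absolutely continuous functions ([prim_sqr]). *)

(** * Quadratic forms *)

Section QuadraticForms.
Variable R : realType.

Definition bf p q (M : 'M[R]_(p, q)) (x : 'cV[R]_p) (y : 'cV[R]_q) : R :=
  (x^T *m M *m y) 0 0.
Definition qf p (M : 'M[R]_p) (x : 'cV[R]_p) : R := bf M x x.
Definition sym p (M : 'M[R]_p) : Prop := M^T = M.
Definition psd p (M : 'M[R]_p) : Prop := forall x, 0 <= qf M x.
Definition pd p (M : 'M[R]_p) : Prop := forall x, x != 0 -> 0 < qf M x.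

Lemma bfDm p q (M N : 'M[R]_(p, q)) x y : bf (M + N) x y = bf M x y + bf N x y.
Proof. by rewrite /bf mulmxDr mulmxDl mxE. Qed.

Lemma bfNm p q (M : 'M[R]_(p, q)) x y : bf (- M) x y = - bf M x y.
Proof. by rewrite /bf mulmxN mulNmx mxE. Qed.

Lemma bfZm p q c (M : 'M[R]_(p, q)) x y : bf (c *: M) x y = c * bf M x y.
Proof. by rewrite /bf -scalemxAr -scalemxAl mxE. Qed.

Lemma bfDl p q (M : 'M[R]_(p, q)) x x' y : bf M (x + x') y = bf M x y + bf M x' y.
Proof. by rewrite /bf linearD /= !mulmxDl mxE. Qed.

Lemma bfDr p q (M : 'M[R]_(p, q)) x y y' : bf M x (y + y') = bf M x y + bf M x y'.
Proof. by rewrite /bf mulmxDr mxE. Qed.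

Lemma bfZl p q (M : 'M[R]_(p, q)) c x y : bf M (c *: x) y = c * bf M x y.
Proof. by rewrite /bf linearZ /= -!scalemxAl mxE. Qed.

Lemma bfZr p q (M : 'M[R]_(p, q)) c x y : bf M x (c *: y) = c * bf M x y.
Proof. by rewrite /bf -scalemxAr mxE. Qed.

Lemma bfBm p q (M N : 'M[R]_(p, q)) x y : bf (M - N) x y = bf M x y - bf N x y.
Proof. by rewrite bfDm bfNm. Qed.

Lemma bf_sum p q (M : 'M[R]_(p, q)) x y :
  bf M x y = \sum_i \sum_j M i j * (x i 0 * y j 0).
Proof.
rewrite /bf mxE exchange_big /=; apply: eq_bigr => j _.
rewrite mxE mulr_suml; apply: eq_bigr => i _; rewrite mxE; ring.
Qed.

Lemma bf_tr p q (M : 'M[R]_(p, q)) x y : bf M^T y x = bf M x y.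
Proof.
rewrite !bf_sum exchange_big; apply: eq_bigr => i _; apply: eq_bigr => j _.
by rewrite mxE [y j 0 * _]mulrC.
Qed.

Lemma bf_delta p q (M : 'M[R]_(p, q)) i j :
  bf M (delta_mx i 0) (delta_mx j 0) = M i j.
Proof.
rewrite bf_sum (bigD1 i) //= (bigD1 j) //= !mxE !eqxx !mulr1.
rewrite big1 ?addr0 => [|k /negPf kj]; last by rewrite !mxE kj !mulr0.
by rewrite big1 ?addr0 // => k /negPf ki; rewrite big1 // => l _; rewrite !mxE ki mul0r mulr0.
Qed.

Lemma bf_mull p q r (M : 'M[R]_(p, q)) (N : 'M[R]_(p, r)) x y :
  bf M (N *m x) y = bf (N^T *m M) x y.
Proof. by rewrite /bf trmx_mul !mulmxA. Qed.

Lemma bf_mulr p q r (M : 'M[R]_(p, q)) (N : 'M[R]_(q, r)) x y :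
  bf M x (N *m y) = bf (M *m N) x y.
Proof. by rewrite /bf !mulmxA. Qed.

Lemma bfC p (M : 'M[R]_p) x y : sym M -> bf M x y = bf M y x.
Proof. by move=> sM; rewrite -bf_tr sM. Qed.

Lemma qfDm p (M N : 'M[R]_p) x : qf (M + N) x = qf M x + qf N x.
Proof. exact: bfDm. Qed.

Lemma qfNm p (M : 'M[R]_p) x : qf (- M) x = - qf M x.
Proof. exact: bfNm. Qed.

Lemma qfBm p (M N : 'M[R]_p) x : qf (M - N) x = qf M x - qf N x.
Proof. exact: bfBm. Qed.

Lemma qfZm p c (M : 'M[R]_p) x : qf (c *: M) x = c * qf M x.
Proof. exact: bfZm. Qed.

Lemma qf0m p x : qf (0 : 'M[R]_p) x = 0.
Proof. by rewrite /qf /bf mulmx0 mul0mx mxE. Qed.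

Lemma qfx0 p (M : 'M[R]_p) : qf M 0 = 0.
Proof. by rewrite /qf /bf mulmx0 mxE. Qed.

Lemma qfZ p c (M : 'M[R]_p) x : qf M (c *: x) = c ^+ 2 * qf M x.
Proof. by rewrite /qf bfZl bfZr mulrA. Qed.

Lemma qfD p (M : 'M[R]_p) x y : sym M -> qf M (x + y) = qf M x + 2 * bf M x y + qf M y.
Proof. by move=> sM; rewrite /qf bfDl !bfDr (bfC y x sM); ring. Qed.

Lemma qf_mul p q (M : 'M[R]_p) (N : 'M[R]_(p, q)) x :
  qf M (N *m x) = qf (N^T *m M *m N) x.
Proof. by rewrite /qf bf_mull bf_mulr. Qed.

Lemma symD p (M N : 'M[R]_p) : sym M -> sym N -> sym (M + N).
Proof. by rewrite /sym linearD /= => -> ->. Qed.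

Lemma symN p (M : 'M[R]_p) : sym M -> sym (- M).
Proof. by rewrite /sym linearN /= => ->. Qed.

Lemma symB p (M N : 'M[R]_p) : sym M -> sym N -> sym (M - N).
Proof. by move=> sM sN; apply: symD => //; apply: symN. Qed.

Lemma symZ p c (M : 'M[R]_p) : sym M -> sym (c *: M).
Proof. by rewrite /sym linearZ /= => ->. Qed.

Lemma sym_conj p q (M : 'M[R]_p) (N : 'M[R]_(p, q)) : sym M -> sym (N^T *m M *m N).
Proof. by rewrite /sym => sM; rewrite !trmx_mul trmxK sM mulmxA. Qed.

Lemma pd_psd p (M : 'M[R]_p) : pd M -> psd M.
Proof.
by move=> pM x; have [->|/pM/ltW//] := eqVneq x 0; rewrite qfx0.
Qed.

Lemma pdD p (M N : 'M[R]_p) : pd M -> psd N -> pd (M + N).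
Proof. by move=> pM pN x x0; rewrite qfDm ltr_wpDr // pM. Qed.

Lemma psdZ p c (M : 'M[R]_p) : 0 <= c -> psd M -> psd (c *: M).
Proof. by move=> c0 pM x; rewrite qfZm mulr_ge0. Qed.

Lemma psd_conj p q (M : 'M[R]_p) (N : 'M[R]_(p, q)) : psd M -> psd (N^T *m M *m N).
Proof. by move=> pM x; rewrite -qf_mul. Qed.

(** Polarization: at a sum of two basis vectors, the diagonal terms cancel and twice the
    corresponding entry remains. *)
Lemma sym_bf_eq p (M N : 'M[R]_p) : sym M -> sym N ->
  (forall x, qf M x = qf N x) -> M = N.
Proof.
move=> sM sN eq; apply/matrixP => i j; rewrite -!bf_delta.
have := eq (delta_mx i 0 + delta_mx j 0); rewrite !qfD // !eq => /addIr /addrI.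
by apply: mulfI; rewrite pnatr_eq0.
Qed.

Lemma psd_antisym p (M : 'M[R]_p) : sym M -> psd M -> psd (- M) -> M = 0.
Proof.
move=> sM pM pN; apply: sym_bf_eq => //; first by rewrite /sym trmx0.
by move=> x; rewrite qf0m; apply/eqP; rewrite eq_le pM andbT -oppr_ge0 -qfNm pN.
Qed.

(** The form is nonnegative on the line [x + t y], so this quadratic polynomial in [t] has
    nonpositive discriminant. *)
Lemma psd_cauchy_schwarz p (M : 'M[R]_p) x y : sym M -> psd M ->
  bf M x y ^+ 2 <= qf M x * qf M y.
Proof.
move=> sM pM; have H t : 0 <= qf M x + 2 * t * bf M x y + t ^+ 2 * qf M y.
  by have := pM (x + t *: y); rewrite qfD // qfZ bfZr mulrA.
have [y0|y0] := eqVneq (qf M y) 0.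
  rewrite y0 mulr0; have [->|b0] := eqVneq (bf M x y) 0; first by rewrite expr0n.
  (* Without its leading coefficient the polynomial is affine in [t]; this [t] would give it the
     value [-1]. *)
  have := H (- (qf M x + 1) / (2 * bf M x y)); rewrite y0 mulr0 addr0.
  have -> : 2 * (- (qf M x + 1) / (2 * bf M x y)) * bf M x y = - (qf M x + 1).
    by field.
  by move=> ?; exfalso; lra.
have yp : 0 < qf M y by rewrite lt_neqAle eq_sym y0 pM.
(* The minimizer of the polynomial. *)
have := H (- bf M x y / qf M y).
have -> : qf M x + 2 * (- bf M x y / qf M y) * bf M x y
    + (- bf M x y / qf M y) ^+ 2 * qf M y = (qf M x * qf M y - bf M x y ^+ 2) / qf M y.
  by field.
by rewrite pmulr_lge0 ?invr_gt0 // subr_ge0.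
Qed.

(** Cauchy-Schwarz against each basis vector kills every entry of [M *m x]. *)
Lemma psd_ker p (M : 'M[R]_p) x : sym M -> psd M -> qf M x = 0 -> M *m x = 0.
Proof.
move=> sM pM x0; apply/matrixP => i j; rewrite (ord1 j) [RHS]mxE.
have := psd_cauchy_schwarz (delta_mx i 0) x sM pM; rewrite x0 mulr0.
rewrite exprn_even_le0 //= => /eqP <-.
by rewrite /bf trmx_delta -rowE -row_mul [RHS]mxE.
Qed.

Lemma inj_unitmx (F : fieldType) p (M : 'M[F]_p) :
  (forall x : 'cV_p, M *m x = 0 -> x = 0) -> M \in unitmx.
Proof.
move=> inj; rewrite -unitmx_tr -row_free_unit -kermx_eq0; apply/eqP/row_matrixP => i.
rewrite row0; apply: trmx_inj; rewrite trmx0; apply: inj.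
by rewrite -[LHS]trmxK trmx_mul trmxK -row_mul mulmx_ker row0 trmx0.
Qed.

Lemma pd_unitmx p (M : 'M[R]_p) : pd M -> M \in unitmx.
Proof.
move=> pM; apply: inj_unitmx => x Mx; apply/eqP/negP => /negP/pM.
by rewrite /qf /bf -mulmxA Mx mulmx0 mxE ltxx.
Qed.

Definition sqn p (x : 'cV[R]_p) : R := \sum_i x i 0 ^+ 2.

Lemma sqn_ge0 p (x : 'cV[R]_p) : 0 <= sqn x.
Proof. by apply: sumr_ge0 => i _; apply: sqr_ge0. Qed.

Lemma sqn_coord p (x : 'cV[R]_p) i : x i 0 ^+ 2 <= sqn x.
Proof. by rewrite /sqn (bigD1 i) //= lerDl sumr_ge0 // => j _; apply: sqr_ge0. Qed.

Lemma sqn_gt0 p (x : 'cV[R]_p) : x != 0 -> 0 < sqn x.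
Proof.
move=> x0; rewrite lt_neqAle sqn_ge0 andbT; apply: contra x0 => /eqP s0.
apply/eqP/matrixP => i j; rewrite (ord1 j) [RHS]mxE; apply/eqP.
by rewrite -sqrf_eq0 eq_le sqr_ge0 andbT s0 sqn_coord.
Qed.

Lemma qf1 p (x : 'cV[R]_p) : qf 1%:M x = sqn x.
Proof. by rewrite /qf /bf mulmx1 mxE; apply: eq_bigr => i _; rewrite mxE. Qed.

Lemma qf_bound p (M : 'M[R]_p) : exists2 c, 0 < c & forall x, `|qf M x| <= c * sqn x.
Proof.
exists (1 + \sum_i \sum_j `|M i j|).
  by rewrite ltr_wpDr // sumr_ge0 // => i _; rewrite sumr_ge0.
move=> x; rewrite /qf bf_sum mulrDl mul1r.
apply: (@le_trans _ _ ((\sum_i \sum_j `|M i j|) * sqn x)); last by rewrite lerDr sqn_ge0.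
rewrite mulr_suml; apply: le_trans (ler_norm_sum _ _ _) _; apply: ler_sum => i _.
rewrite mulr_suml; apply: le_trans (ler_norm_sum _ _ _) _; apply: ler_sum => j _.
rewrite normrM ler_wpM2l //; have := sqn_coord x i; have := sqn_coord x j.
by move=> Hj Hi; rewrite ler_norml; apply/andP; split; nra.
Qed.

(* Cauchy-Schwarz for the form of [M] applied to [M^-1 x] and [x] gives
   [sqn x ^+ 2 <= qf M^-1 x * qf M x], so no compactness is needed. *)
Lemma pd_coercive p (M : 'M[R]_p) : sym M -> pd M ->
  exists2 c, 0 < c & forall x, c * sqn x <= qf M x.
Proof.
move=> sM pM; have uM := pd_unitmx pM.
have [c c0 Hc] := qf_bound (invmx M).
exists c^-1; first by rewrite invr_gt0.
move=> x; have [->|x0] := eqVneq x 0.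
  by rewrite qfx0 /sqn big1 ?mulr0 // => i _; rewrite mxE expr0n.
have := psd_cauchy_schwarz (invmx M *m x) x sM (pd_psd pM).
rewrite bf_mull trmx_inv sM mulVmx // -/(qf _ x) qf1 qf_mul trmx_inv sM mulVmx // mul1mx.
have s0 := sqn_gt0 x0; move=> H.
have H2 : sqn x ^+ 2 <= (c * sqn x) * qf M x.
  apply: le_trans H _; rewrite ler_wpM2r ?(pd_psd pM) //.
  exact: le_trans (ler_norm _) (Hc x).
by rewrite mulrC ler_pdivrMr // -(ler_pM2l s0) -expr2; apply: le_trans H2 _; rewrite le_eqVlt; apply/orP; left; apply/eqP; ring.
Qed.

End QuadraticForms.

(** * Lyapunov operators *)

Section Lyapunov.
Variable R : realType.
Implicit Types (h : R).

(** For [h > 0] this is the difference quotient of the form of [P] along the step from [x] to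
    [x + h F x]; for [h = 0] it is the derivative of that form along [x' = F x]. *)
Definition lyap h p (F P : 'M[R]_p) : 'M[R]_p :=
  F^T *m P + P *m F + h *: (F^T *m P *m F).

Lemma addmx_entry p q (M N : 'M[R]_(p, q)) i j : (M + N) i j = M i j + N i j.
Proof. exact: mxE. Qed.

Lemma scalemx_entry p q c (M : 'M[R]_(p, q)) i j : (c *: M) i j = c * M i j.
Proof. exact: mxE. Qed.

Lemma oppmx_entry p q (M : 'M[R]_(p, q)) i j : (- M) i j = - M i j.
Proof. exact: mxE. Qed.

Lemma lyap_is_linear h p (F : 'M[R]_p) : linear (lyap h F).
Proof.
move=> c P Q; rewrite /lyap !(mulmxDl, mulmxDr) -!(scalemxAl, scalemxAr).
by apply/matrixP => i j; rewrite !(addmx_entry, scalemx_entry); ring.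
Qed.

HB.instance Definition _ h p (F : 'M[R]_p) :=
  GRing.isLinear.Build R 'M[R]_p 'M[R]_p _ (lyap h F) (lyap_is_linear h F).

Lemma lyap_sym h p (F P : 'M[R]_p) : sym P -> sym (lyap h F P).
Proof.
move=> sP; apply: symD; last by apply: symZ; apply: sym_conj.
by rewrite /sym linearD /= !trmx_mul trmxK sP addrC.
Qed.

Lemma qf_lyap h p (F P : 'M[R]_p) x : sym P ->
  qf (lyap h F P) x = 2 * bf P x (F *m x) + h * qf P (F *m x).
Proof.
move=> sP; rewrite !qfDm qfZm qf_mul; congr (_ + _).
by rewrite /qf -bf_mull -bf_mulr (bfC _ x sP); ring.
Qed.

(** A null vector of the form lies in the kernel of [P], so the terms linear in [F] vanish and only
    [h * qf P (F *m x)] is left. *)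
Lemma qf_lyap_ker h p (F P : 'M[R]_p) x : 0 <= h -> sym P -> psd P -> qf P x = 0 ->
  0 <= qf (lyap h F P) x.
Proof.
move=> h0 sP pP /(psd_ker sP pP) Px; rewrite qf_lyap // (bfC _ _ sP).
by rewrite /bf -mulmxA Px mulmx0 mxE mulr0 add0r mulr_ge0.
Qed.

(* The discrete-time operator for [F] is [lyap 1 (F - 1)], the continuous-time
   one is [lyap 0 F]; this order-theoretic property characterizes stability of
   both. *)
Definition stable h p (F : 'M[R]_p) : Prop :=
  forall P, sym P -> psd (- lyap h F P) -> psd P.

(* If [P] is not [>= 0], take the largest generalized eigenvalue [t > 0] of
   [- P] relative to [X]: then [P + t X] is [>= 0] and singular, which
   contradicts [qf_lyap_ker]. *)
Lemma lyap_stable h p (F X : 'M[R]_p) : 0 <= h -> sym X -> pd X ->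
  pd (- lyap h F X) -> stable h F.
Proof.
move=> h0 sX pX pL P sP pP; apply: contrapT => nP.
have [x0 Px0] : exists x, qf P x < 0.
  by apply: contrapT => H; apply: nP => x; rewrite leNgt; apply/negP => ?; apply: H; exists x.
have x0N : x0 != 0 by apply: contraTneq Px0 => ->; rewrite qfx0 ltxx.
pose E : set R := [set - qf P x / qf X x | x in [set x | x != 0]]%classic.
have [c c0 Hc] := qf_bound P; have [d d0 Hd] := pd_coercive sX pX.
have [e e0 He] := qf_bound X.
have Eub : ubound E (c / d).
  move=> _ [x /= xN <-]; have s0 := sqn_gt0 xN.
  rewrite ler_pdivrMr ?pX // mulrAC ler_pdivlMr //.
  apply: (@le_trans _ _ (c * sqn x * d)).
    by rewrite ler_wpM2r ?(ltW d0) // (le_trans _ (Hc x)) // -normrN ler_norm.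
  by rewrite -mulrA ler_wpM2l ?(ltW c0) // mulrC.
have hE : has_sup E by split; [exists (- qf P x0 / qf X x0); exists x0|exists (c / d)].
pose t := sup E.
have Et x : x != 0 -> - qf P x <= t * qf X x.
  move=> xN; rewrite -ler_pdivrMr ?pX //.
  by apply: sup_upper_bound => //; exists x.
have t0 : 0 < t.
  by have := Et x0 x0N; have := pX _ x0N; rewrite /t => ? ?; nra.
have sY : sym (P + t *: X) by apply: symD => //; apply: symZ.
have pY : psd (P + t *: X).
  move=> x; have [->|xN] := eqVneq x 0; first by rewrite qfx0.
  by rewrite qfDm qfZm; have := Et x xN; lra.
have [w wN Yw] : exists2 w, w != 0 & qf (P + t *: X) w = 0.
  apply: contrapT => H.
  have pdY : pd (P + t *: X).
    move=> x xN; rewrite lt_neqAle pY andbT eq_sym.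
    by apply/negP => /eqP ?; apply: H; exists x.
  (* If [P + t X] were coercive, [t] could be lowered by [g / e] and still bound every quotient,
     against its being the supremum. *)
  have [g g0 Hg] := pd_coercive sY pdY.
  have : t <= t - g / e.
    apply: ge_sup; first by case: hE.
    move=> _ [x /= xN <-]; rewrite ler_pdivrMr ?pX //.
    have := Hg x; rewrite qfDm qfZm => Hgx.
    have s0 := sqn_gt0 xN.
    have ex : qf X x <= e * sqn x by exact: le_trans (ler_norm _) (He x).
    have : g / e * qf X x <= g * sqn x.
      by rewrite mulrAC ler_pdivrMr // -mulrA ler_wpM2l ?(ltW g0) // mulrC.
    lra.
  by have := divr_gt0 g0 e0; lra.
(* At [w] the value for [P + t X] is nonnegative, yet it is a nonpositive term plus [t] times a
   negative one. *)
have := qf_lyap_ker F h0 sY pY Yw; rewrite linearD linearZ /= qfDm qfZm.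
have := pL w wN; rewrite qfNm; have := pP w; rewrite qfNm => ? ? ?.
nra.
Qed.

(* [lyap] on the symmetric part plus the identity on the antisymmetric part:
   injectivity on all matrices gives solvability on the symmetric ones. *)
Definition lyap_ext h p (F P : 'M[R]_p) : 'M[R]_p := lyap h F (P + P^T) + (P - P^T).

Lemma lyap_ext_is_linear h p (F : 'M[R]_p) : linear (lyap_ext h F).
Proof.
move=> c P Q; have -> : lyap_ext h F (c *: P + Q) = lyap h F (c *: P + Q + (c *: P^T + Q^T)) + (c *: P + Q - (c *: P^T + Q^T)).
  by rewrite /lyap_ext; congr (lyap _ _ (_ + _) + (_ - _)); exact: linearP.
rewrite /lyap_ext.
have -> : c *: P + Q + (c *: P^T + Q^T) = c *: (P + P^T) + (Q + Q^T).
  by rewrite scalerDr addrACA.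
rewrite linearP; apply/matrixP => i j.
by rewrite !(addmx_entry, oppmx_entry, scalemx_entry); ring.
Qed.

HB.instance Definition _ h p (F : 'M[R]_p) :=
  GRing.isLinear.Build R 'M[R]_p 'M[R]_p _ (lyap_ext h F) (lyap_ext_is_linear h F).

Lemma symDtr p (P : 'M[R]_p) : sym (P + P^T).
Proof. by rewrite /sym linearD /= trmxK addrC. Qed.

(** Transposing the equation only flips the sign of [P - P^T], since the [lyap] term and [W] are
    symmetric; hence [P - P^T] vanishes. *)
Lemma lyap_ext_parts h p (F P W : 'M[R]_p) : sym W -> lyap_ext h F P = W ->
  lyap h F (P + P^T) = W /\ P = P^T.
Proof.
rewrite /lyap_ext => sW; set T := lyap _ _ _ => E.
have E' : T - (P - P^T) = W.
  rewrite -sW -E [RHS]linearD /= [(P - _)^T]linearB /= trmxK.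
  by rewrite [T^T](lyap_sym _ _ (symDtr P)) opprB.
have D0 : P - P^T = 0.
  have : (P - P^T) *+ 2 = 0.
    by rewrite mulr2n -{1}[P - P^T](addrK T) [_ + T]addrC E -addrA [- T + _]addrC -opprB E' subrr.
  by move=> /eqP; rewrite -scaler_nat scaler_eq0 pnatr_eq0 /= => /eqP.
by split; [rewrite -E D0 addr0|apply/eqP; rewrite -subr_eq0 D0].
Qed.

(** In finite dimension injectivity of [lyap_ext] suffices. For [P] in its kernel, stability applies
    to [P + P^T] and to its negative, so both are positive semidefinite and [P + P^T] is zero. *)
Lemma stable_lyap_solve h p (F W : 'M[R]_p) : stable h F -> sym W ->
  exists2 P, sym P & lyap h F P = W.
Proof.
move=> sF sW.
have uL : lin_mx (lyap_ext h F) \in unitmx.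
  rewrite -unitmx_tr; apply: inj_unitmx => x /(congr1 trmx).
  rewrite trmx_mul trmxK trmx0 -[x^T]vec_mxK mul_vec_lin => /(congr1 vec_mx).
  rewrite mxvecK linear0; set P := vec_mx _ => LP.
  have [|L0 PT] := lyap_ext_parts _ LP; first by rewrite /sym trmx0.
  have P0 : P + P^T = 0.
    apply: psd_antisym; first exact: symDtr.
      by apply: sF; [exact: symDtr|move=> y; rewrite L0 oppr0 qf0m].
    apply: sF; first by apply: symN; exact: symDtr.
    by move=> y; rewrite linearN /= L0 !oppr0 qf0m.
  move: P0; rewrite -PT -mulr2n => /eqP; rewrite -scaler_nat scaler_eq0 pnatr_eq0 /= => /eqP P0.
  by apply: trmx_inj; rewrite trmx0 -[x^T]vec_mxK -/P P0 linear0.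
pose P : 'M[R]_p := vec_mx (mxvec W *m invmx (lin_mx (lyap_ext h F))).
have LP : lyap_ext h F P = W.
  by apply: (can_inj mxvecK); rewrite -mul_vec_lin vec_mxK mulmxKV.
have [LW _] := lyap_ext_parts sW LP.
by exists (P + P^T); [exact: symDtr|].
Qed.

End Lyapunov.

(** * Policy iteration for the Riccati equation *)

Section MatrixLimits.
Variable R : realType.
Local Open Scope classical_set_scope.

Definition mxcvg p q (u : nat -> 'M[R]_(p, q)) (M : 'M[R]_(p, q)) : Prop :=
  forall i j, u k i j @[k --> \oo] --> M i j.

Lemma cvg_bigsum (T I : Type) (F : set_system T) (FF : Filter F) (r : seq I)
    (P : pred I) (f : I -> T -> R) (l : I -> R) :
  (forall i, f i k @[k --> F] --> l i) ->
  \sum_(i <- r | P i) f i k @[k --> F] --> \sum_(i <- r | P i) l i.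
Proof.
move=> H; elim: r => [|i r IH].
  rewrite big_nil; under eq_fun do rewrite big_nil.
  exact: cvg_cst.
rewrite big_cons; under eq_fun do rewrite big_cons.
by case: (P i) => //; apply: cvgD.
Qed.

Lemma cvg_bigprod (T I : Type) (F : set_system T) (FF : Filter F) (r : seq I)
    (P : pred I) (f : I -> T -> R) (l : I -> R) :
  (forall i, f i k @[k --> F] --> l i) ->
  \prod_(i <- r | P i) f i k @[k --> F] --> \prod_(i <- r | P i) l i.
Proof.
move=> H; elim: r => [|i r IH].
  rewrite big_nil; under eq_fun do rewrite big_nil.
  exact: cvg_cst.
rewrite big_cons; under eq_fun do rewrite big_cons.
by case: (P i) => //; apply: cvgM.
Qed.

Lemma mxcvg_cst p q (M : 'M[R]_(p, q)) : mxcvg (fun=> M) M.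
Proof. by move=> i j; apply: cvg_cst. Qed.

Lemma mxcvgD p q (u v : nat -> 'M[R]_(p, q)) M N :
  mxcvg u M -> mxcvg v N -> mxcvg (fun k => u k + v k) (M + N).
Proof.
by move=> uM vN i j; rewrite mxE; under eq_fun do rewrite mxE; apply: cvgD.
Qed.

Lemma mxcvgN p q (u : nat -> 'M[R]_(p, q)) M :
  mxcvg u M -> mxcvg (fun k => - u k) (- M).
Proof. by move=> uM i j; rewrite mxE; under eq_fun do rewrite mxE; apply: cvgN. Qed.

Lemma mxcvgZ p q c (u : nat -> 'M[R]_(p, q)) M :
  mxcvg u M -> mxcvg (fun k => c *: u k) (c *: M).
Proof.
by move=> uM i j; rewrite mxE; under eq_fun do rewrite mxE; apply: cvgM => //; apply: cvg_cst.
Qed.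

Lemma mxcvg_mul p q r (u : nat -> 'M[R]_(p, q)) (v : nat -> 'M[R]_(q, r)) M N :
  mxcvg u M -> mxcvg v N -> mxcvg (fun k => u k *m v k) (M *m N).
Proof.
move=> uM vN i j; rewrite mxE; under eq_fun do rewrite mxE.
by apply: cvg_bigsum => l; apply: cvgM.
Qed.

Lemma mxcvg_tr p q (u : nat -> 'M[R]_(p, q)) M :
  mxcvg u M -> mxcvg (fun k => (u k)^T) M^T.
Proof. by move=> uM i j; rewrite mxE; under eq_fun do rewrite mxE; apply: uM. Qed.

Lemma mxcvg_det p (u : nat -> 'M[R]_p) M :
  mxcvg u M -> \det (u k) @[k --> \oo] --> \det M.
Proof.
move=> uM; apply: cvg_bigsum => s; apply: cvgM; first exact: cvg_cst.
by apply: cvg_bigprod => i; apply: uM.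
Qed.

(** By the adjugate formula: determinant and cofactors are polynomials in the entries. *)
Lemma mxcvg_inv p (u : nat -> 'M[R]_p) M : M \in unitmx ->
  (forall k, u k \in unitmx) -> mxcvg u M -> mxcvg (fun k => invmx (u k)) (invmx M).
Proof.
move=> UM Uu uM i j; rewrite /invmx UM; under eq_fun do rewrite Uu mxE [X in _ * X]mxE.
rewrite mxE [X in _ * X]mxE; apply: cvgM.
  apply: cvgV; last exact: mxcvg_det.
  by rewrite -unitfE; move: UM; rewrite unitmxE.
apply: cvgM; first exact: cvg_cst.
by apply: mxcvg_det => k l; rewrite 2!mxE; under eq_fun do rewrite 2!mxE; apply: uM.
Qed.

Lemma mxcvg_unique p q (u : nat -> 'M[R]_(p, q)) M N :
  mxcvg u M -> mxcvg u N -> M = N.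
Proof.
move=> uM uN; apply/matrixP => i j.
exact: (cvg_unique (@Rhausdorff R) (uM i j) (uN i j)).
Qed.

Lemma mxcvg_shift p q (u : nat -> 'M[R]_(p, q)) M :
  mxcvg u M -> mxcvg (fun k => u k.+1) M.
Proof. by move=> uM i j; have := uM i j; rewrite -cvg_shiftS. Qed.

Lemma mxcvg_psd p (u : nat -> 'M[R]_p) M : mxcvg u M -> (forall k, psd (u k)) -> psd M.
Proof.
move=> uM pu x.
have : qf (u k) x @[k --> \oo] --> qf M x.
  rewrite /qf bf_sum; under eq_fun do rewrite bf_sum.
  apply: cvg_bigsum => i; apply: cvg_bigsum => j.
  by apply: cvgM; [apply: uM|apply: cvg_cst].
move=> cv; rewrite -(cvg_lim _ cv) //; apply: limr_ge; first by apply/cvg_ex; exists (qf M x).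
by apply: nearW => k; apply: pu.
Qed.

(** Each value [qf (u k) x] is nonincreasing in [k] and bounded below by 0, hence converges;
    polarization turns this into convergence of the entries. *)
Lemma psd_decreasing_cvg p (u : nat -> 'M[R]_p) : (forall k, sym (u k)) ->
  (forall k, psd (u k)) -> (forall k, psd (u k - u k.+1)) ->
  exists M, mxcvg u M.
Proof.
move=> su pu du.
have cv x : cvgn (fun k => qf (u k) x).
  apply: nonincreasing_is_cvgn; last by exists 0 => _ [k _ <-]; apply: pu.
  apply/nonincreasing_seqP => k; rewrite -subr_ge0 -qfBm; exact: du.
exists (\matrix_(i, j) limn (fun k => (qf (u k) (delta_mx i 0 + delta_mx j 0)
   - qf (u k) (delta_mx i 0) - qf (u k) (delta_mx j 0)) / 2)).
move=> i j; rewrite mxE.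
have -> : (fun k => u k i j) = (fun k => (qf (u k) (delta_mx i 0 + delta_mx j 0)
   - qf (u k) (delta_mx i 0) - qf (u k) (delta_mx j 0)) / 2).
  by apply/funext => k; rewrite qfD // bf_delta; field.
apply: is_cvgM; last exact: is_cvg_cst.
by apply: is_cvgB => //; apply: is_cvgB.
Qed.

End MatrixLimits.

(** * Riccati residual, policy iteration, existence and uniqueness *)

Section Riccati.
Variables (R : realType) (n m : nat) (h : R).
Variables (a : 'M[R]_n) (b : 'M[R]_(n, m)) (q : 'M[R]_n) (r : 'M[R]_m).
Hypotheses (h0 : 0 <= h) (sq : sym q) (pq : pd q) (sr : sym r) (pr : pd r).

Definition ricS (P : 'M[R]_n) : 'M[R]_m := r + h *: (b^T *m P *m b).
(** The factor [1 + h a] is the identity for [h = 0] and the original transition matrix for [h = 1],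
    where [a] is that matrix minus the identity. *)
Definition ricN (P : 'M[R]_n) : 'M[R]_(m, n) := b^T *m P *m (1%:M + h *: a).
Definition gain (P : 'M[R]_n) : 'M[R]_(m, n) := - (invmx (ricS P) *m ricN P).
(** The residual of the Riccati equation, which [P] solves when this is 0. *)
Definition ric (P : 'M[R]_n) : 'M[R]_n :=
  lyap h a P + q - (ricN P)^T *m invmx (ricS P) *m ricN P.

Lemma ricS_sym P : sym P -> sym (ricS P).
Proof. by move=> sP; apply: symD => //; apply: symZ; apply: sym_conj. Qed.

Lemma ricS_pd P : psd P -> pd (ricS P).
Proof. by move=> pP; apply: pdD => //; apply: psdZ => //; apply: psd_conj. Qed.

Lemma ric_sym P : sym P -> sym (ric P).
Proof.
move=> sP; apply: symB; first by apply: symD => //; apply: lyap_sym.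
by apply: sym_conj; rewrite /sym trmx_inv ricS_sym.
Qed.

(** The left side is the rate of change of the form of [P] under the control [u] plus the running
    cost. It is quadratic in [u] with leading part [ricS P], and [gain P *m x] is its minimizer. *)
Lemma complete_square P x u : sym P -> psd P ->
  2 * bf P x (a *m x + b *m u) + h * qf P (a *m x + b *m u) + qf q x + qf r u =
  qf (ric P) x + qf (ricS P) (u - gain P *m x).
Proof.
move=> sP pP; have sS := ricS_sym sP; have US := pd_unitmx (ricS_pd pP).
have SgE : ricS P *m gain P = - ricN P by rewrite /gain mulmxN mulKVmx.
(* The cross term of the square reproduces the part of the left side that is bilinear in [u] and
   [x], because [ricS P *m gain P = - ricN P]. *)
have E1 : bf (ricS P) u (gain P *m x) = - bf P (b *m u) (x + h *: (a *m x)).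
  rewrite bf_mulr SgE bfNm bf_mull -[x in x + _]mul1mx scalemxAl -mulmxDl.
  by rewrite bf_mulr.
have E2 : qf (ricS P) (gain P *m x) = qf ((ricN P)^T *m invmx (ricS P) *m ricN P) x.
  rewrite qf_mul -mulmxA SgE mulmxN /gain linearN /= mulNmx opprK trmx_mul.
  by rewrite trmx_inv sS.
rewrite (qfD u _ sS) -[- (gain P *m x)]scaleN1r qfZ bfZr E1 E2.
rewrite /ric qfBm qfDm qf_lyap // /ricS qfDm qfZm -[qf (_ *m invmx _ *m _) _]qf_mul.
rewrite (qfD _ _ sP) [qf P (b *m u)]qf_mul !bfDr bfZr (bfC _ (b *m u) sP) (bfC (b *m u) (a *m x) sP).
ring.
Qed.

(** Completion of the square at [u = K x]. Policy improvement, the limit equation and uniqueness are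
    all read off from this identity, whose last term is positive semidefinite and vanishes for
    [K = gain P]. *)
Lemma lyap_closed_loop P K : sym P -> psd P ->
  lyap h (a + b *m K) P + q + K^T *m r *m K =
  ric P + (K - gain P)^T *m ricS P *m (K - gain P).
Proof.
move=> sP pP; apply: sym_bf_eq.
- by apply: symD; [apply: symD => //; apply: lyap_sym|apply: sym_conj].
- by apply: symD; [apply: ric_sym|apply: sym_conj; apply: ricS_sym].
move=> x; rewrite [LHS]qfDm [qf (_ + q) x]qfDm qfDm -!qf_mul qf_lyap // !mulmxDl mulNmx -mulmxA.
by rewrite complete_square.
Qed.

Lemma cost_pd K : pd (q + K^T *m r *m K).
Proof. by apply: pdD => //; apply: psd_conj; apply: pd_psd. Qed.

(** Here [P] is a strict Lyapunov matrix of its own closed loop, since [lyap] equals [ric P] minus a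
    positive definite matrix. A null vector of its form would contradict [qf_lyap_ker], so [P] is
    definite. *)
Lemma gain_stable P : sym P -> psd P -> psd (- ric P) -> pd P /\ stable h (a + b *m gain P).
Proof.
move=> sP pP rP.
have L : lyap h (a + b *m gain P) P = ric P - (q + (gain P)^T *m r *m gain P).
  have := lyap_closed_loop (gain P) sP pP.
  by rewrite subrr mulmx0 addr0 => <-; rewrite -(addrA (lyap _ _ _)) addrK.
have pL : pd (- lyap h (a + b *m gain P) P).
  by rewrite L opprB; apply: pdD => //; apply: cost_pd.
have pdP : pd P.
  move=> x xN; rewrite lt_neqAle pP andbT eq_sym; apply/negP => /eqP Px.
  have := qf_lyap_ker (a + b *m gain P) h0 sP pP Px.
  by have := pL x xN; rewrite qfNm; lra.
by split=> //; apply: lyap_stable pL.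
Qed.

Lemma policy_evaluation K : stable h (a + b *m K) ->
  exists2 P, sym P /\ psd P & lyap h (a + b *m K) P = - (q + K^T *m r *m K).
Proof.
move=> sK.
have [|P sP LP] := stable_lyap_solve (W := - (q + K^T *m r *m K)) sK.
  by apply: symN; apply: symD => //; apply: sym_conj.
by exists P => //; split => //; apply: sK => //; rewrite LP opprK; apply: pd_psd; apply: cost_pd.
Qed.

(* Kleinman's policy iteration: evaluate the cost [P] of a stabilizing gain,
   then replace the gain by [gain P]. *)
Lemma policy_iteration K : stable h (a + b *m K) ->
  exists u : nat -> 'M[R]_n,
    [/\ forall k, sym (u k), forall k, psd (u k), forall k, psd (u k - u k.+1) &
      forall k, lyap h (a + b *m gain (u k)) (u k.+1) =
                - (q + (gain (u k))^T *m r *m gain (u k))].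
Proof.
move=> sK.
(* The invariant of the iteration: a nonpositive residual makes [gain P] stabilizing. *)
pose good P := [/\ sym P, psd P & psd (- ric P)].
(* For the cost matrix of any gain, the residual is minus the square term of [lyap_closed_loop]. *)
have good_eval P K' : sym P -> psd P ->
    lyap h (a + b *m K') P = - (q + K'^T *m r *m K') -> good P.
  move=> sP pP LP; split => //; have := lyap_closed_loop K' sP pP.
  rewrite LP -addrA addNr => /esym/eqP; rewrite addrC addr_eq0 => /eqP <-.
  by apply: psd_conj; apply: pd_psd; apply: ricS_pd.
have next P : good P -> exists P', [/\ good P', psd (P - P') &
    lyap h (a + b *m gain P) P' = - (q + (gain P)^T *m r *m gain P)].
  move=> [sP pP rP]; have [_ sG] := gain_stable sP pP rP.
  have [P' [sP' pP'] LP'] := policy_evaluation sG.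
  exists P'; split => //; first exact: good_eval LP'.
  (* Improvement: under the new closed loop [lyap] sends [P - P'] to [ric P], which is
     nonpositive. *)
  apply: sG; first exact: symB.
  have := lyap_closed_loop (gain P) sP pP.
  rewrite subrr mulmx0 addr0 linearB /= LP' opprK addrA => ->.
  exact: rP.
have [P0 [sP0 pP0] LP0] := policy_evaluation sK.
have gP0 := good_eval _ _ sP0 pP0 LP0.
(* Carrying the invariant in the type lets the next iterate be chosen by a function, so that the
   sequence is defined by recursion. *)
pose T := {P | good P}.
have next' (P : T) : {P' : T | psd (sval P - sval P') /\
    lyap h (a + b *m gain (sval P)) (sval P') =
      - (q + (gain (sval P))^T *m r *m gain (sval P))}.
  apply: cid; case: P => P gP /=; have [P' [gP' dP LP']] := next P gP.
  by exists (exist _ P' gP').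
pose u := fix u k : T := if k is k'.+1 then sval (next' (u k')) else exist _ P0 gP0.
exists (fun k => sval (u k)); split => k.
- by case: (u k) => ? [].
- by case: (u k) => ? [].
- by rewrite /=; case: (next' (u k)) => ? [].
- by rewrite /=; case: (next' (u k)) => ? [].
Qed.

Lemma mxcvg_gain u P : (forall k, sym (u k)) -> (forall k, psd (u k)) -> mxcvg u P ->
  mxcvg (fun k => gain (u k)) (gain P).
Proof.
move=> su pu uP; have pP := mxcvg_psd uP pu.
apply: mxcvgN; apply: mxcvg_mul.
  apply: mxcvg_inv => [|k|].
  - by apply: pd_unitmx; apply: ricS_pd.
  - by apply: pd_unitmx; apply: ricS_pd.
  apply: mxcvgD; first exact: mxcvg_cst.
  apply: mxcvgZ; apply: mxcvg_mul; last exact: mxcvg_cst.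
  by apply: mxcvg_mul => //; apply: mxcvg_cst.
apply: mxcvg_mul; last exact: mxcvg_cst.
by apply: mxcvg_mul => //; apply: mxcvg_cst.
Qed.

(** The iterates decrease to some [P]. In the limit the evaluation equation holds for [P] with its
    own gain, where [lyap_closed_loop] has no square term and thus says [ric P = 0]. *)
Theorem riccati_exists K : stable h (a + b *m K) ->
  exists P, [/\ sym P, pd P, ric P = 0 & stable h (a + b *m gain P)].
Proof.
move=> sK; have [u [su pu du Lu]] := policy_iteration sK.
have [P uP] := psd_decreasing_cvg su pu du.
have sP : sym P.
  apply: mxcvg_unique (uP); have := mxcvg_tr uP.
  by have -> : (fun k => (u k)^T) = u by apply/funext => k; apply: su.
have pP := mxcvg_psd uP pu.
have gP := mxcvg_gain su pu uP.
have FP : mxcvg (fun k => a + b *m gain (u k)) (a + b *m gain P).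
  apply: mxcvgD; first exact: mxcvg_cst.
  by apply: mxcvg_mul => //; apply: mxcvg_cst.
have L1 : mxcvg (fun k => lyap h (a + b *m gain (u k)) (u k.+1)) (lyap h (a + b *m gain P) P).
  have uS := mxcvg_shift uP.
  apply: mxcvgD; first apply: mxcvgD.
  - by apply: mxcvg_mul => //; apply: mxcvg_tr.
  - exact: mxcvg_mul.
  - by apply: mxcvgZ; apply: mxcvg_mul => //; apply: mxcvg_mul => //; apply: mxcvg_tr.
have L2 : mxcvg (fun k => lyap h (a + b *m gain (u k)) (u k.+1))
    (- (q + (gain P)^T *m r *m gain P)).
  have -> : (fun k => lyap h (a + b *m gain (u k)) (u k.+1)) =
            (fun k => - (q + (gain (u k))^T *m r *m gain (u k))).
    by apply/funext.
  apply: mxcvgN; apply: mxcvgD; first exact: mxcvg_cst.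
  apply: mxcvg_mul => //; apply: mxcvg_mul; last exact: mxcvg_cst.
  exact: mxcvg_tr.
have ric0 : ric P = 0.
  have := lyap_closed_loop (gain P) sP pP.
  by rewrite (mxcvg_unique L1 L2) subrr mulmx0 addr0 -addrA addNr.
have [|pdP sG] := gain_stable sP pP; first by rewrite ric0 oppr0 => x; rewrite qf0m.
by exists P.
Qed.

(** Under the stable closed loop of [P1], [lyap] sends [P1 - P2] to minus the square term belonging
    to [P2], so [P1 - P2] is positive semidefinite; exchanging the two solutions gives equality. *)
Theorem riccati_unique P P' : sym P -> pd P -> ric P = 0 ->
  sym P' -> pd P' -> ric P' = 0 -> P' = P.
Proof.
suff le P1 P2 : sym P1 -> pd P1 -> ric P1 = 0 -> sym P2 -> pd P2 -> ric P2 = 0 -> psd (P1 - P2).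
  move=> sP pP rP sP' pP' rP'; apply/eqP; rewrite -subr_eq0; apply/eqP.
  by apply: psd_antisym; [exact: symB|exact: le|rewrite opprB; exact: le].
move=> s1 p1 r1 s2 p2 r2.
have [|_ sG] := gain_stable s1 (pd_psd p1); first by rewrite r1 oppr0 => x; rewrite qf0m.
apply: sG; first exact: symB.
have E1 := lyap_closed_loop (gain P1) s1 (pd_psd p1).
have E2 := lyap_closed_loop (gain P1) s2 (pd_psd p2).
move: E1 E2; rewrite subrr mulmx0 r1 r2 addr0 add0r -!(addrA (lyap _ _ _)).
move=> /eqP; rewrite (addr_eq0 (lyap _ _ _)) => /eqP E1 E2.
rewrite linearB /= E1 opprB opprK E2.
by apply: psd_conj; apply: pd_psd; apply: ricS_pd; apply: pd_psd.
Qed.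

End Riccati.

(** * Absolutely continuous functions *)

Section Primitives.
Variable R : realType.
Local Open Scope classical_set_scope.
Local Notation mu := (@lebesgue_measure R).

(** Cutting where [Phi] takes its middle value replaces one squared increment by two of a quarter
    its size, so each bisection halves the bound on the increment of [g]. *)
Lemma bisection_eq (Phi g : R -> R) (s t : R) : s <= t ->
  {within `[s, t], continuous Phi} ->
  (forall a b, s <= a -> a <= b -> b <= t -> Phi a <= Phi b) ->
  (forall a b, s <= a -> a <= b -> b <= t -> `|g b - g a| <= (Phi b - Phi a) ^+ 2) ->
  g t = g s.
Proof.
move=> st cPhi mPhi Hg.
have H N : forall a b, s <= a -> a <= b -> b <= t ->
    `|g b - g a| <= (Phi b - Phi a) ^+ 2 / 2 ^+ N.
  elim: N => [|N IH] a b sa ab bt; first by rewrite expr0 divr1 Hg.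
  have Pab := mPhi _ _ sa ab bt.
  have [||c] := @IVT _ Phi a b ((Phi a + Phi b) / 2) ab.
  - by apply: continuous_subspaceW cPhi; apply: subset_itv; rewrite bnd_simp.
  - by rewrite /Num.min /Num.max; case: ltP => ?; apply/andP; split; lra.
  rewrite in_itv /= => /andP[ac cb] Ec.
  have H1 := IH a c sa ac (le_trans cb bt).
  have H2 := IH c b (le_trans sa ac) cb bt.
  have p0 : 0 < 2 ^+ N :> R by rewrite exprn_gt0.
  have -> : g b - g a = (g b - g c) + (g c - g a) by ring.
  apply: le_trans (ler_normD _ _) _; apply: le_trans (lerD H2 H1) _.
  rewrite Ec (exprS 2) le_eqVlt; apply/orP; left; apply/eqP.
  by move: (2 ^+ N) p0 => e /lt0r_neq0 e0; field.
apply/eqP; rewrite -subr_eq0; apply/negPn/negP => gN.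
have d0 : 0 < `|g t - g s| by rewrite normr_gt0.
set c := (Phi t - Phi s) ^+ 2 in H *.
have c0 : 0 <= c / `|g t - g s| by rewrite divr_ge0 // sqr_ge0.
(* Any [N] above this quotient works, since [2 ^ N] exceeds [N]. *)
have := archi_boundP c0; set N := Num.bound _ => cN.
have := H N _ _ (lexx s) st (lexx t); rewrite -/c.
rewrite ler_pdivlMr ?exprn_gt0 // leNgt => /negP; apply.
rewrite mulrC -ltr_pdivrMr //; apply: lt_trans cN _.
by rewrite -natrX ltr_nat ltn_expl.
Qed.

Lemma loc_integrable_sub (v : R -> R) s t : loc_integrable v -> 0 <= s ->
  mu.-integrable `]s, t] (EFin \o v).
Proof.
move=> iv s0; have [st|ts] := leP s t.
  apply: integrableS (iv t (le_trans s0 st)) => //.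
  by apply: subset_itv; rewrite bnd_simp.
by rewrite set_itv_ge ?bnd_simp -?leNgt ?(ltW ts) //; exact: integrable_set0.
Qed.

Lemma loc_integrableD (v w : R -> R) :
  loc_integrable v -> loc_integrable w -> loc_integrable (fun s => v s + w s).
Proof.
move=> iv iw t t0; have -> : EFin \o (fun s => v s + w s) = ((EFin \o v) \+ (EFin \o w))%E by [].
by apply: integrableD => //; [exact: iv|exact: iw].
Qed.

Lemma loc_integrableZ c (v : R -> R) : loc_integrable v -> loc_integrable (fun s => c * v s).
Proof.
move=> iv t t0.
have -> : EFin \o (fun s => c * v s) = (fun s => c%:E * (EFin \o v) s)%E by [].
by apply: integrableZl => //; exact: iv.
Qed.

Lemma loc_integrable0 : loc_integrable (fun=> 0 : R).
Proof. by move=> t t0; exact: integrable0. Qed.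

Lemma loc_integrable_norm (v : R -> R) : loc_integrable v -> loc_integrable (fun s => `|v s|).
Proof.
move=> iv t t0.
have -> : EFin \o (fun s => `|v s|) = (fun s => `| (EFin \o v) s |)%E by [].
by apply: integrable_abse; exact: iv.
Qed.

(* [x] is an absolutely continuous function on [[0, +oo[] starting at [x0],
   with almost everywhere derivative [v]. *)
Definition prim (x0 : R) (x v : R -> R) : Prop :=
  loc_integrable v /\
  forall t : R, 0 <= t -> x t = x0 + \int[mu]_(s in `[0, t]) v s.

Lemma prim_eqv x0 x v w : prim x0 x v -> (forall s, v s = w s) -> prim x0 x w.
Proof. by move=> H /funext <-. Qed.

Lemma prim_cst c : prim c (fun=> c) (fun=> 0).
Proof.
split; first exact: loc_integrable0.
by move=> t t0; rewrite Rintegral_cst // mul0r addr0.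
Qed.

Lemma primD x0 x v y0 y w : prim x0 x v -> prim y0 y w ->
  prim (x0 + y0) (fun t => x t + y t) (fun t => v t + w t).
Proof.
move=> [iv Hx] [iw Hy]; split; first exact: loc_integrableD.
by move=> t t0; rewrite Hx // Hy // RintegralD //; [ring|exact: iv|exact: iw].
Qed.

Lemma primZ c x0 x v : prim x0 x v -> prim (c * x0) (fun t => c * x t) (fun t => c * v t).
Proof.
move=> [iv Hx]; split; first exact: loc_integrableZ.
by move=> t t0; rewrite Hx // RintegralZl //; [ring|exact: iv].
Qed.

Lemma prim_sum (I : Type) (r : seq I) (x0 : I -> R) (x v : I -> R -> R) :
  (forall i, prim (x0 i) (x i) (v i)) ->
  prim (\sum_(i <- r) x0 i) (fun t => \sum_(i <- r) x i t) (fun t => \sum_(i <- r) v i t).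
Proof.
move=> H; elim: r => [|i r IH].
  have E (f : I -> R -> R) : (fun t => \sum_(j <- [::]) f j t) = (fun=> 0).
    by apply/funext => t; rewrite big_nil.
  by rewrite big_nil !E; exact: prim_cst.
have E (f : I -> R -> R) :
    (fun t => \sum_(j <- i :: r) f j t) = (fun t => f i t + \sum_(j <- r) f j t).
  by apply/funext => t; rewrite big_cons.
by rewrite big_cons !E; exact: primD.
Qed.

Lemma prim_increment x0 x v (s t : R) : prim x0 x v -> 0 <= s -> s <= t ->
  x t - x s = \int[mu]_(r in `]s, t]) v r.
Proof.
move=> [iv Hx] s0 st; have t0 := le_trans s0 st.
rewrite -(@Rintegral_itvB _ v (BLeft 0) (BRight t) s) ?bnd_simp //; last exact: iv.
by rewrite (Hx t) // (Hx s) //; ring.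
Qed.

Lemma prim_continuous x0 x v (t : R) : prim x0 x v -> 0 <= t -> {within `[0, t], continuous x}.
Proof.
move=> [iv Hx] t0.
apply: (@subspace_eq_continuous _ _ _ (cst x0 + (fun r => \int[mu]_(s in `[0, r]) v s)) x).
  by move=> r; rewrite inE /= in_itv /= => /andP[r0 _]; rewrite [RHS]Hx.
apply: within_continuousD; first by apply: continuous_subspaceT => ?; exact: cvg_cst.
by apply: parameterized_integral_continuous => //; exact: iv.
Qed.

Lemma prim_measurable x0 x v (t : R) : prim x0 x v -> measurable_fun `[0, t] x.
Proof.
move=> px; have [t0|t0] := leP 0 t; last first.
  by rewrite set_itv_ge ?bnd_simp -?ltNge //; exact: measurable_fun_set0.
apply: subspace_continuous_measurable_fun => //; exact: prim_continuous px t0.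
Qed.

Lemma prim_variation x0 x v (s t : R) : prim x0 x v -> 0 <= s -> s <= t ->
  `|x t - x s| <= \int[mu]_(r in `[0, t]) `|v r| - \int[mu]_(r in `[0, s]) `|v r|.
Proof.
move=> px s0 st; have [iv _] := px; have t0 := le_trans s0 st.
rewrite (prim_increment px) // (@Rintegral_itvB _ _ (BLeft 0) (BRight t) s) ?bnd_simp //.
  by apply: le_normr_Rintegral => //; exact: loc_integrable_sub.
exact: loc_integrable_norm.
Qed.

Lemma prim_bounded x0 x v (t : R) : prim x0 x v -> 0 <= t -> [bounded x s | s in `[0, t]].
Proof.
move=> px t0; have [iv Hx] := px.
have H s : 0 <= s -> s <= t -> `|x s| <= `|x 0| + \int[mu]_(r in `[0, t]) `|v r|.
  move=> s0 st.
  have H0 := prim_variation px (lexx 0) s0.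
  have H1 := prim_variation px s0 st.
  have := ler_normD (x s - x 0) (x 0); rewrite subrK.
  have : 0 <= \int[mu]_(r in `[0, 0]) `|v r| by apply: Rintegral_ge0 => ? _.
  have := normr_ge0 (x t - x s).
  lra.
exists (`|x 0| + \int[mu]_(r in `[0, t]) `|v r|); split; first exact: num_real.
move=> M ltM s /=; rewrite in_itv /= => /andP[s0 st].
exact: le_trans (H s s0 st) (ltW ltM).
Qed.

Lemma loc_integrable_mul x0 x v w : prim x0 x v -> loc_integrable w ->
  loc_integrable (fun s => x s * w s).
Proof.
move=> px iw t t0.
have -> : EFin \o (fun s => x s * w s) = ((EFin \o x) \* (EFin \o w))%E by [].
apply: integrableMr => //; [exact: prim_measurable px|exact: prim_bounded px t0|exact: iw].
Qed.

(** Over []a, b]] the function [x ^ 2] minus its candidate integral increases by the integral of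
    [((x b - x r) - (x r - x a)) v r]. With [Phi] the integral of [|v|], the bracket is at most
    [Phi b - Phi a], so the increment is at most the square of that difference and [bisection_eq]
    applies. *)
Lemma prim_sqr x0 x v : prim x0 x v ->
  prim (x0 ^+ 2) (fun t => x t ^+ 2) (fun t => 2 * (x t * v t)).
Proof.
move=> px; have [iv Hx] := px.
pose w s := 2 * (x s * v s).
have iw : loc_integrable w by apply: loc_integrableZ; exact: loc_integrable_mul px iv.
split=> // t t0.
pose g s := x s ^+ 2 - \int[mu]_(r in `[0, s]) w r.
pose Phi s := \int[mu]_(r in `[0, s]) `|v r|.
have inv := loc_integrable_norm iv.
suff : g t = g 0.
  rewrite /g set_itv1 Rintegral_set1 subr0 [x 0]Hx // set_itv1 Rintegral_set1 addr0 => <-.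
  by rewrite subrK.
have PhiB a b : 0 <= a -> a <= b -> \int[mu]_(r in `]a, b]) `|v r| = Phi b - Phi a.
  move=> a0 ab; rewrite /Phi (@Rintegral_itvB _ _ (BLeft 0) (BRight b) a) ?bnd_simp //.
  by apply: inv; exact: le_trans ab.
apply: (@bisection_eq Phi) => //.
- by apply: parameterized_integral_continuous => //; exact: inv.
- move=> a b a0 ab _; rewrite -subr_ge0 -PhiB //.
  by apply: Rintegral_ge0 => ? _.
move=> a b a0 ab bt; have b0 := le_trans a0 ab.
have iwab := loc_integrable_sub b iw a0.
have ivab := loc_integrable_sub b iv a0.
have -> : g b - g a = \int[mu]_(r in `]a, b]) ((x b + x a) * v r - w r).
  rewrite RintegralB //; last by apply: loc_integrable_sub => //; exact: loc_integrableZ.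
  rewrite RintegralZl // -(prim_increment px) //.
  rewrite -(@Rintegral_itvB _ w (BLeft 0) (BRight b) a) ?bnd_simp //; last exact: iw.
  by rewrite /g; ring.
pose e r := (x b + x a) * v r - w r; rewrite -/e.
have i1 : mu.-integrable `]a, b] (EFin \o e).
  pose e1 r := (x b + x a) * v r.
  have -> : EFin \o e = ((EFin \o e1) \- (EFin \o w))%E by [].
  by apply: integrableB => //; apply: loc_integrable_sub => //; exact: loc_integrableZ.
apply: le_trans (le_normr_Rintegral _ i1) _ => //.
apply: (@le_trans _ _ (\int[mu]_(r in `]a, b]) ((Phi b - Phi a) * `|v r|))).
  apply: le_Rintegral => //.
  - exact: (integrable_abse i1).
  - by apply: loc_integrable_sub => //; exact: loc_integrableZ.
  move=> r /=; rewrite in_itv /= => /andP[/ltW ar rb].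
  have -> : e r = ((x b - x r) - (x r - x a)) * v r by rewrite /e /w; ring.
  rewrite normrM ler_wpM2r //; apply: le_trans (ler_normB _ _) _.
  have H1 : `|x r - x a| <= Phi r - Phi a := prim_variation px a0 ar.
  have H2 : `|x b - x r| <= Phi b - Phi r := prim_variation px (le_trans a0 ar) rb.
  by apply: le_trans (lerD H2 H1) _; rewrite subrKA.
rewrite RintegralZl //; last by apply: loc_integrable_sub.
by rewrite PhiB // expr2.
Qed.

(** Polarization: [x y] is a quarter of [(x + y) ^ 2 - (x - y) ^ 2]. *)
Lemma primM x0 x v y0 y w : prim x0 x v -> prim y0 y w ->
  prim (x0 * y0) (fun t => x t * y t) (fun t => v t * y t + x t * w t).
Proof.
move=> px py.
have pa := primZ 4^-1 (prim_sqr (primD px py)).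
have pb := primZ (- 4^-1) (prim_sqr (primD px (primZ (-1) py))).
have := primD pa pb.
have -> : 4^-1 * (x0 + y0) ^+ 2 + - 4^-1 * (x0 + -1 * y0) ^+ 2 = x0 * y0 by field.
have -> : (fun t => 4^-1 * (x t + y t) ^+ 2 + - 4^-1 * (x t + -1 * y t) ^+ 2) =
  (fun t => x t * y t) by apply/funext => t; field.
by move/prim_eqv; apply => t; field.
Qed.

(* The real counterpart of [ct_integral_eq]. *)
Definition vprim p (x0 : 'cV[R]_p) (x v : R -> 'cV[R]_p) : Prop :=
  forall i, prim (x0 i 0) (fun t => x t i 0) (fun t => v t i 0).

Lemma vprim_qf p (P : 'M[R]_p) x0 x v : sym P -> vprim x0 x v ->
  prim (qf P x0) (fun t => qf P (x t)) (fun t => 2 * bf P (x t) (v t)).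
Proof.
move=> sP px.
have H : prim (\sum_i \sum_j P i j * (x0 i 0 * x0 j 0))
   (fun t => \sum_i \sum_j P i j * (x t i 0 * x t j 0))
   (fun t => \sum_i \sum_j P i j * (v t i 0 * x t j 0 + x t i 0 * v t j 0)).
  by apply: prim_sum => i; apply: prim_sum => j; apply: primZ; apply: primM.
have -> : qf P x0 = \sum_i \sum_j P i j * (x0 i 0 * x0 j 0) by exact: bf_sum.
have -> : (fun t => qf P (x t)) = (fun t => \sum_i \sum_j P i j * (x t i 0 * x t j 0)).
  by apply/funext => t; exact: bf_sum.
apply: prim_eqv H _ => t.
have -> : 2 * bf P (x t) (v t) = bf P (v t) (x t) + bf P (x t) (v t).
  by rewrite (bfC _ _ sP); ring.
rewrite !bf_sum -big_split; apply: eq_bigr => i _; rewrite -big_split.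
by apply: eq_bigr => j _; rewrite mulrDr.
Qed.

End Primitives.

(** * Linear differential equations *)

Section LinearODE.
Variables (R : realType) (p : nat) (F : 'M[R]_p).
Local Open Scope classical_set_scope.
Local Notation mu := (@lebesgue_measure R).

(** Power series coefficients in [t] of the [i]-th coordinate of [exp (t F) x0]. *)
Definition ode_coef (x0 : 'cV[R]_p) (i : 'I_p) (k : nat) : R := iter k (mulmx F) x0 i 0 / k`!%:R.

Definition ode_sol (x0 : 'cV[R]_p) (t : R) : 'cV[R]_p := \col_i limn (pseries (ode_coef x0 i) t).

Lemma iter_mulmx_bound (x0 : 'cV[R]_p) : exists c L, [/\ 0 <= c, 0 <= L &
  forall k i, `|iter k (mulmx F) x0 i 0| <= c * L ^+ k].
Proof.
exists (\sum_i `|x0 i 0|), (\sum_i \sum_j `|F i j|).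
have L0 : 0 <= \sum_i \sum_j `|F i j| by apply: sumr_ge0 => i _; apply: sumr_ge0.
have c0 : 0 <= \sum_i `|x0 i 0| by apply: sumr_ge0.
split=> //; elim=> [|k IH] i.
  by rewrite expr0 mulr1 (bigD1 i) //= lerDl sumr_ge0.
rewrite iterS mxE exprS mulrCA.
set M := _ * _ in IH *; have M0 : 0 <= M by rewrite mulr_ge0 // exprn_ge0.
apply: le_trans (ler_norm_sum _ _ _) _.
apply: (@le_trans _ _ ((\sum_j `|F i j|) * M)).
  rewrite mulr_suml; apply: ler_sum => j _; rewrite normrM ler_wpM2l //; exact: IH.
rewrite ler_wpM2r // [leRHS](bigD1 i) //= lerDl sumr_ge0 // => j _.
by apply: sumr_ge0.
Qed.

(** Comparison with [c] times the exponential series at [L |t|]. *)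
Lemma is_cvg_ode (x0 : 'cV[R]_p) i t : cvgn (pseries (ode_coef x0 i) t).
Proof.
have [c [L [c0 L0 H]]] := iter_mulmx_bound x0.
apply: normed_cvg.
apply: (@series_le_cvg _ _ (c *: exp_coeff (L * `|t|))) => [n|n|n|].
- exact: normr_ge0.
- rewrite [X in _ <= X](_ : _ = c * ((L * `|t|) ^+ n / n`!%:R)) //.
  by rewrite mulr_ge0 // divr_ge0 // exprn_ge0 // mulr_ge0.
- rewrite [X in _ <= X](_ : _ = c * ((L * `|t|) ^+ n / n`!%:R)) //.
  rewrite /ode_coef /= normrM normrX normf_div (ger0_norm (ler0n _ _)).
  rewrite exprMn !mulrA [leRHS]mulrAC ler_wpM2r ?exprn_ge0 //.
  by rewrite ler_wpM2r // invr_ge0.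
- by apply: is_cvg_seriesZ; exact: is_cvg_series_exp_coeff.
Qed.

(** Termwise differentiation shifts the coefficients, which amounts to starting from [F *m x0]. *)
Lemma pseries_diffs_ode (x0 : 'cV[R]_p) i : pseries_diffs (ode_coef x0 i) = ode_coef (F *m x0) i.
Proof.
apply/funext => k; rewrite /pseries_diffs /ode_coef iterSr factS natrM.
by rewrite invfM mulrCA mulVKf.
Qed.

Lemma ode_sol_deriv (x0 : 'cV[R]_p) t : ode_sol (F *m x0) t = F *m ode_sol x0 t.
Proof.
apply/matrixP => i j; rewrite (ord1 j) [LHS]mxE [RHS]mxE.
apply: cvg_lim => //.
under eq_bigr do rewrite mxE.
have -> : pseries (ode_coef (F *m x0) i) t =
    (fun n => \sum_j F i j * pseries (ode_coef x0 j) t n).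
  apply/funext => n; rewrite /pseries /series /=.
  under [RHS]eq_bigr do rewrite mulr_sumr.
  rewrite exchange_big /=; apply: eq_bigr => k _.
  rewrite /ode_coef -iterSr iterS mxE !mulr_suml; apply: eq_bigr => l _.
  by rewrite !mulrA.
apply: (@cvg_bigsum R _ _ \oo _ _ xpredT (fun l k => F i l * pseries (ode_coef x0 l) t k)) => l.
by apply: cvgM; [exact: cvg_cst|exact: is_cvg_ode].
Qed.

Lemma ode_sol0 (x0 : 'cV[R]_p) : ode_sol x0 0 = x0.
Proof.
apply/matrixP => i j; rewrite (ord1 j) mxE; apply: cvg_lim => //.
(* The partial sum of index 0 is empty; all later ones equal [x0 i 0]. *)
rewrite -cvg_shiftS.
have -> : [sequence pseries (ode_coef x0 i) 0 n.+1]_n = cst (x0 i 0).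
  apply/funext => n; rewrite /pseries /series /= big_nat_recl //= big1 => [|k _].
    by rewrite /ode_coef /= fact0 divr1 expr0 mulr1 addr0.
  by rewrite expr0n mulr0.
exact: cvg_cst.
Qed.

Lemma is_derive_ode (x0 : 'cV[R]_p) i t :
  is_derive t (1 : R) (fun t => ode_sol x0 t i 0) ((F *m ode_sol x0 t) i 0).
Proof.
have -> : (fun t => ode_sol x0 t i 0) = (fun t => limn (pseries (ode_coef x0 i) t)).
  by apply/funext => s; rewrite mxE.
rewrite -ode_sol_deriv mxE -pseries_diffs_ode.
(* The series and its termwise derivatives must converge at a point of modulus larger than [|t|]. *)
apply: (@pseries_snd_diffs _ _ (`|t| + 1)); rewrite ?pseries_diffs_ode.
- exact: is_cvg_ode.
- exact: is_cvg_ode.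
- exact: is_cvg_ode.
- by rewrite [ltRHS]ger0_norm ?addr_ge0 // ltrDl.
Qed.

Lemma continuous_ode (x0 : 'cV[R]_p) i : continuous (fun t => ode_sol x0 t i 0).
Proof.
move=> t; apply/differentiable_continuous/derivable1_diffP.
by have [] := is_derive_ode x0 i t.
Qed.

(** Asymptotic stability speaks only of given solutions, so one must be exhibited before it says
    anything; the optimal trajectory is obtained from here too. *)
Theorem vprim_exists (x0 : 'cV[R]_p) : vprim x0 (ode_sol x0) (fun t => F *m ode_sol x0 t).
Proof.
move=> i.
have cv : continuous (fun t => (F *m ode_sol x0 t) i 0).
  have -> : (fun t => (F *m ode_sol x0 t) i 0) = (fun t => ode_sol (F *m x0) t i 0).
    by apply/funext => t; rewrite ode_sol_deriv.
  exact: continuous_ode.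
split=> [t t0|t].
  apply: continuous_compact_integrable; first exact: segment_compact.
  exact: continuous_subspaceT.
rewrite le_eqVlt => /predU1P[<-|t0].
  by rewrite set_itv1 Rintegral_set1 addr0 ode_sol0.
rewrite /Rintegral (@continuous_FTC2 _ _ (fun t => ode_sol x0 t i 0)) //=.
- by rewrite ode_sol0 [RHS]addrC subrK.
- exact: continuous_subspaceT.
- split=> [s _||].
  + by have [] := is_derive_ode x0 i s.
  + by apply: cvg_at_right_filter; exact: continuous_ode.
  + by apply: cvg_at_left_filter; exact: continuous_ode.
- by move=> s _; rewrite derive1E; have := is_derive_ode x0 i s => H; rewrite derive_val.
Qed.

End LinearODE.

(** * Continuous-time regulator *)

Section QuadraticFormLimits.
Variable R : realType.
Local Open Scope classical_set_scope.

Lemma qf_cvg0 T (F : set_system T) (FF : Filter F) p (P : 'M[R]_p) (x : T -> 'cV[R]_p) :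
  (forall i, x t i 0 @[t --> F] --> (0 : R)) -> qf P (x t) @[t --> F] --> (0 : R).
Proof.
move=> x0; have -> : 0 = \sum_i \sum_j P i j * (0 * 0) :> R.
  by rewrite big1 // => i _; rewrite big1 // => j _; rewrite !mulr0.
have -> : (fun t => qf P (x t)) = (fun t => \sum_i \sum_j P i j * (x t i 0 * x t j 0)).
  by apply/funext => t; exact: bf_sum.
apply: cvg_bigsum => i; apply: cvg_bigsum => j.
by apply: cvgM; [exact: cvg_cst|apply: cvgM; exact: x0].
Qed.

Lemma pd_cvg0 T (F : set_system T) (FF : Filter F) p (P : 'M[R]_p) (x : T -> 'cV[R]_p) :
  sym P -> pd P -> qf P (x t) @[t --> F] --> (0 : R) ->
  forall i, x t i 0 @[t --> F] --> (0 : R).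
Proof.
move=> sP pP Px i; have [c c0 Hc] := pd_coercive sP pP.
apply/cvgr0Pnorm_lt => e e0.
have ce0 : 0 < c * e ^+ 2 by rewrite mulr_gt0 // exprn_gt0.
near=> t; have : `|qf P (x t)| < c * e ^+ 2 by near: t; exact: cvgr0_norm_lt Px _ ce0.
rewrite ger0_norm ?(pd_psd pP) // => /(le_lt_trans (Hc _)).
rewrite ltr_pM2l // => /(le_lt_trans (sqn_coord (x t) i)).
by rewrite -(real_normK (num_real _)) ltr_pXn2r ?nnegrE // ltW.
Unshelve. all: by end_near. Qed.

Lemma measurable_qf d (T : measurableType d) (D : set T) p (P : 'M[R]_p) (x : T -> 'cV[R]_p) :
  (forall i, measurable_fun D (fun t => x t i 0)) -> measurable_fun D (fun t => qf P (x t)).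
Proof.
move=> mx.
have -> : (fun t => qf P (x t)) = (fun t => \sum_i \sum_j P i j * (x t i 0 * x t j 0)).
  by apply/funext => t; exact: bf_sum.
apply: (measurable_sum _ (h := fun i t => \sum_j P i j * (x t i 0 * x t j 0))) => i.
apply: (measurable_sum _ (h := fun j t => P i j * (x t i 0 * x t j 0))) => j.
by apply: measurable_funM => //; apply: measurable_funM.
Qed.

End QuadraticFormLimits.

(** * Stability, cost and optimal control in continuous time *)

Section ContinuousTime.
Variable R : realType.
Local Open Scope classical_set_scope.
Local Notation mu := (@lebesgue_measure R).

Definition ct_real_stable p (F : 'M[R]_p) : Prop :=
  forall x0 x, vprim x0 x (fun s => F *m x s) ->
  forall i, x t i 0 @[t --> +oo] --> (0 : R).

Lemma prim_ge x0 (x v : R -> R) t : prim x0 x v -> (forall s, 0 <= v s) -> 0 <= t -> x0 <= x t.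
Proof.
move=> [_ Hx] v0 t0; rewrite Hx // lerDl; apply: Rintegral_ge0 => s _; exact: v0.
Qed.

(** The form of [- P] is nondecreasing along the solution and tends to 0, so it starts
    nonpositive. *)
Lemma ct_real_stableP p (F : 'M[R]_p) : ct_real_stable F -> stable 0 F.
Proof.
move=> sF P sP pL x0; rewrite -oppr_le0 -qfNm.
have px := vprim_exists F x0; have sN := symN sP.
have pV := vprim_qf sN px.
have cV := qf_cvg0 (@proper_pinfty_nbhs R) (- P) (sF _ _ px).
have V0 : \forall t \near +oo, qf (- P) x0 <= qf (- P) (ode_sol F x0 t).
  near=> t; apply: (prim_ge pV) => [s|]; last by near: t; exact: nbhs_pinfty_ge.
  by have := pL (ode_sol F x0 s); rewrite -linearN qf_lyap // mul0r addr0.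
rewrite -(cvg_lim _ cV) //; apply: limr_ge => //.
by apply/cvg_ex; exists 0.
Unshelve. all: by end_near. Qed.

Variables (n m : nat) (a : 'M[R]_n) (b : 'M[R]_(n, m)) (q : 'M[R]_n) (r : 'M[R]_m).
Variable P : 'M[R]_n.
Hypotheses (sq : sym q) (pq : pd q) (sr : sym r) (pr : pd r).
Hypotheses (sP : sym P) (pP : pd P) (ricP : ric 0 a b q r P = 0).
Let K := gain 0 a b r P.

Section Trajectory.
Variables (x0 : 'cV[R]_n) (x : R -> 'cV[R]_n) (u : R -> 'cV[R]_m).
Hypotheses (iu : forall j, loc_integrable (fun s => u s j 0)).
Hypothesis px : vprim x0 x (fun s => a *m x s + b *m u s).

Let c t := qf q (x t) + qf r (u t).
(** The excess over the optimal cost rate; for [h = 0] the weight [ricS] is [r] itself. *)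
Let e t := qf r (u t - K *m x t).
Let V t := qf P (x t).

Let c_ge0 t : 0 <= c t.
Proof. by rewrite addr_ge0 //; apply: pd_psd. Qed.

Let e_ge0 t : 0 <= e t.
Proof. exact: pd_psd. Qed.

Let V_ge0 t : 0 <= V t.
Proof. exact: pd_psd. Qed.

Let prim_V : prim (qf P x0) V (fun t => e t - c t).
Proof.
apply: prim_eqv (vprim_qf sP px) _ => t.
have := complete_square a b q (lexx 0) sr pr (x t) (u t) sP (pd_psd pP).
rewrite ricP qf0m mul0r addr0 add0r /ricS scale0r addr0 -/K -/(e t) => <-.
by rewrite /c; ring.
Qed.

Let measurable_x (t : R) i : measurable_fun `[0, t] (fun s => x s i 0).
Proof. exact: prim_measurable (px i). Qed.

Let measurable_u (t : R) i : measurable_fun `[0, t] (fun s => u s i 0).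
Proof.
have [t0|t0] := leP 0 t; first by apply/measurable_EFinP; exact: measurable_int (iu i t0).
by rewrite set_itv_ge ?bnd_simp -?ltNge //; exact: measurable_fun_set0.
Qed.

Let measurable_c (t : R) : measurable_fun `[0, t] c.
Proof. by apply: measurable_funD; apply: measurable_qf. Qed.

Let measurable_e (t : R) : measurable_fun `[0, t] e.
Proof.
apply: measurable_qf => i.
have -> : (fun s => (u s - K *m x s) i 0) = (fun s => u s i 0 - \sum_j K i j * x s j 0).
  by apply/funext => s; rewrite !mxE.
apply: measurable_funB => //.
apply: (measurable_sum _ (h := fun j s => K i j * x s j 0)) => j.
exact: measurable_funM.
Qed.

Let measurable_cy : measurable_fun `[(0 : R), +oo[ c.
Proof. by rewrite itv0y_bigcup0S; apply/measurable_fun_bigcup. Qed.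

Let J := (\int[mu]_(t in `[0%R, +oo[) (c t)%:E)%E.

Let int_c_le (t : R) : (\int[mu]_(s in `[0%R, t]) (c s)%:E <= J)%E.
Proof.
apply: ge0_subset_integral => //.
- exact/measurable_EFinP.
- by move=> s _; rewrite lee_fin.
- by move=> s /=; rewrite !in_itv /= andbT => /andP[].
Qed.

(** A control that is only locally integrable need not make [e] integrable. Finite cost makes [c]
    integrable, and [e - c] is the derivative of [V], so [e] is integrable as well. *)
Let energy (t : R) : 0 <= t -> (J < +oo)%E ->
  (\int[mu]_(s in `[0%R, t]) (c s)%:E + (V t)%:E =
   (qf P x0)%:E + \int[mu]_(s in `[0%R, t]) (e s)%:E)%E.
Proof.
move=> t0 Jy.
have ic : mu.-integrable `[0, t] (EFin \o c).
  apply/integrableP; split.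
    by apply/measurable_EFinP; exact: measurable_c.
  apply: le_lt_trans Jy; apply: le_trans (int_c_le t).
  by under eq_integral do rewrite /= ger0_norm //.
have [ig HV] := prim_V.
have ie : mu.-integrable `[0, t] (EFin \o e).
  have -> : EFin \o e = ((EFin \o (fun s => (e s - c s)%R)) \+ (EFin \o c))%E.
    by apply/funext => s /=; rewrite -EFinD subrK.
  by apply: integrableD => //; exact: ig.
have fc : (\int[mu]_(s in `[0%R, t]) (c s)%:E)%E = (\int[mu]_(s in `[0, t]) c s)%:E.
  by rewrite /Rintegral fineK //; exact: integrable_fin_num.
have fe : (\int[mu]_(s in `[0%R, t]) (e s)%:E)%E = (\int[mu]_(s in `[0, t]) e s)%:E.
  by rewrite /Rintegral fineK //; exact: integrable_fin_num.
rewrite fc fe -!EFinD HV // RintegralB //; congr EFin; ring.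
Qed.

(** Otherwise the running cost stays above a positive constant on a half-line, and [J] is
    infinite. *)
Let V_small (T eps : R) : (J < +oo)%E -> 0 <= T -> 0 < eps ->
  exists2 t, T <= t & V t < eps.
Proof.
move=> Jy T0 eps0; apply: contrapT => H.
have VT t : T <= t -> eps <= V t by move=> Tt; rewrite leNgt; apply/negP => ?; apply: H; exists t.
have [d d0 Hd] := pd_coercive sq pq; have [g g0 Hg] := qf_bound P.
(* Since [V <= g * sqn x] and [d * sqn x <= qf q x], the bound [eps <= V] forces a running cost of
   at least [d / g * eps]. *)
have delta0 : 0 < d / g * eps by rewrite mulr_gt0 // divr_gt0.
have : (\int[mu]_(t in `[T, +oo[) cst (d / g * eps)%:E t <= J)%E.
  apply: (@le_trans _ _ (\int[mu]_(t in `[T, +oo[) (c t)%:E)%E).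
    apply: ge0_le_integral => //.
    - by move=> t _; rewrite lee_fin ltW.
    - apply/measurable_EFinP; apply: measurable_funS measurable_cy => //.
      by apply: subset_itvr; rewrite bnd_simp.
    move=> t /=; rewrite in_itv /= andbT => Tt; rewrite lee_fin /c.
    have H1 : V t <= g * sqn (x t) := le_trans (ler_norm _) (Hg (x t)).
    apply: (@le_trans _ _ (qf q (x t))); last by rewrite lerDl; apply: pd_psd.
    apply: le_trans (Hd (x t)).
    rewrite mulrAC ler_pdivrMr // -mulrA ler_pM2l // mulrC.
    exact: le_trans (VT t Tt) _.
  apply: ge0_subset_integral => //.
  - exact/measurable_EFinP.
  - by move=> s _; rewrite lee_fin.
  - by apply: subset_itvr; rewrite bnd_simp.
rewrite integral_cst //= lebesgue_measure_itv /= ltry gt0_muley ?lte_fin //.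
by rewrite leye_eq => /eqP JE; rewrite JE ltxx in Jy.
Qed.

(** The energy identity is read at a time [t >= T] with [V t < eps]; enlarging [[0, T]] to [[0, t]]
    only increases the integral of [e]. *)
Lemma ct_cost_lower (T : R) : 0 <= T ->
  ((qf P x0)%:E + \int[mu]_(s in `[0%R, T]) (e s)%:E <= J)%E.
Proof.
move=> T0; have [Jy|] := ltP J +oo%E; last by rewrite leye_eq => /eqP ->; exact: leey.
apply/lee_addgt0Pr => eps eps0.
have [t Tt Vt] := V_small Jy T0 eps0.
have t0 := le_trans T0 Tt.
apply: (@le_trans _ _ ((qf P x0)%:E + \int[mu]_(s in `[0%R, t]) (e s)%:E)%E).
  apply: leeD2l; apply: ge0_subset_integral => //.
  - by apply/measurable_EFinP; exact: measurable_e.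
  - by move=> s _; rewrite lee_fin.
  - by apply: subset_itvl; rewrite bnd_simp.
by rewrite -energy // leeD // lee_fin ltW.
Qed.

Lemma ct_cost_ge : ((qf P x0)%:E <= J)%E.
Proof.
apply: le_trans (ct_cost_lower (lexx 0)).
by rewrite leeDl // integral_ge0 // => s _; rewrite lee_fin.
Qed.

Lemma ct_cost_eq : J = (qf P x0)%:E -> {ae mu, forall t : R, 0 <= t -> u t = K *m x t}.
Proof.
move=> JE.
(* Exhausting the half-line by the intervals [[0, k]] leaves only countably many null sets to
   unite. *)
have e0 (k : nat) : {ae mu, forall t : R, `[(0 : R), k%:R] t -> e t = 0}.
  have : (\int[mu]_(s in `[0%R, k%:R]) (e s)%:E)%E = 0%E.
    apply/eqP; rewrite eq_le integral_ge0 ?andbT => [|s _]; last by rewrite lee_fin.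
    have := ct_cost_lower (ler0n R k); rewrite JE -{2}[(qf P x0)%:E]adde0.
    by rewrite leeD2lE.
  move=> E; have : (\int[mu]_(s in `[0%R, k%:R]) `|(EFin \o e) s|)%E = 0%E.
    by rewrite -E; apply: eq_integral => s _ /=; rewrite ger0_norm.
  move/ae_eq_integral_abs => H.
  have {}H : ae_eq mu `[0, k%:R] (EFin \o e) (cst 0%E).
    by apply: H => //; apply/measurable_EFinP; exact: measurable_e.
  by apply: filterS H => t Ht /Ht [].
have := ae_foralln e0; apply: filterS => t Ht t0.
have /Ht et : `[(0 : R), (Num.bound t)%:R] t.
  by rewrite /= in_itv /= t0 ltW // archi_boundP.
apply/eqP; rewrite -subr_eq0; apply/negPn/negP => /pr.
by rewrite -/(e t) et ltxx.
Qed.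

Hypothesis uK : forall t, u t = K *m x t.

Let e0 t : e t = 0.
Proof. by rewrite /e uK subrr qfx0. Qed.

(** Under the feedback [e] vanishes, so the cost up to [t] is [qf P x0 - V t], at most [qf P x0];
    monotone convergence passes to the half-line. *)
Lemma ct_cost_feedback : J = (qf P x0)%:E.
Proof.
apply/eqP; rewrite eq_le ct_cost_ge andbT.
have [ig HV] := prim_V.
have int_c (t : R) : 0 <= t -> (\int[mu]_(s in `[0%R, t]) (c s)%:E <= (qf P x0)%:E)%E.
  (* Writing [c] as minus the derivative of [V] gives its integrability before [J] is known to be
     finite. *)
  move=> t0; have -> : c = (fun s => -1 * (e s - c s)) by apply/funext => s; rewrite e0; ring.
  have im := loc_integrableZ (-1) ig.
  rewrite -[X in (X <= _)%E]fineK; last by apply: integrable_fin_num => //; exact: im.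
  rewrite lee_fin -[X in X <= _]/(\int[mu]_(s in `[0, t]) (-1 * (e s - c s))).
  rewrite RintegralZl //; last exact: ig.
  by have := V_ge0 t; rewrite HV //; lra.
rewrite /J itv0y_bigcup0S.
pose D (k : nat) := `[(0 : R), k.+1%:R]%classic.
have ndD : nondecreasing_seq D.
  move=> i j ij; apply/subsetPset; apply: subset_itvl; rewrite bnd_simp ler_nat ltnS.
  exact: ij.
have mD k : measurable (D k) by exact: measurable_itv.
have mc k : measurable_fun (D k) (EFin \o c).
  by apply/measurable_EFinP; exact: measurable_c.
have c0 k s : D k s -> (0 <= (EFin \o c) s)%E by rewrite lee_fin.
have cv := @ge0_nondecreasing_set_cvg_integral _ _ _ _ _ mu ndD mD mc c0.
rewrite -(cvg_lim _ cv) //; apply: lime_le; first by apply/cvg_ex; eexists; exact: cv.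
by apply: nearW => k; exact: (int_c _ (ler0n _ k.+1)).
Qed.

(** [V] is nonincreasing because its derivative is [- c], and it becomes arbitrarily small, so it
    tends to 0; definiteness of [P] carries this to the coordinates. *)
Lemma ct_feedback_stable i : x t i 0 @[t --> +oo] --> (0 : R).
Proof.
move: i; apply: (pd_cvg0 _ sP pP); apply/cvgr0Pnorm_lt => eps eps0.
have Jy : (J < +oo)%E by rewrite ct_cost_feedback ltry.
have [T T0 VT] := V_small Jy (lexx 0) eps0.
near=> t; have Tt : T <= t by near: t; apply: nbhs_pinfty_ge; exact: num_real.
rewrite ger0_norm ?(pd_psd pP) //; apply: le_lt_trans VT.
rewrite -/(V t) -subr_ge0 -opprB oppr_ge0 (prim_increment prim_V T0 Tt).
rewrite -oppr_ge0 -mulN1r -RintegralZl //; last by apply: loc_integrable_sub T0; case: prim_V.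
by apply: Rintegral_ge0 => s _; rewrite e0 sub0r mulN1r opprK.
Unshelve. all: by end_near. Qed.

End Trajectory.

End ContinuousTime.

(** * Discrete-time regulator *)

Section DiscreteTime.
Variable R : realType.
Local Open Scope classical_set_scope.

Definition dt_real_stable p (F : 'M[R]_p) : Prop :=
  forall (x0 : 'cV[R]_p) i, iter t (mulmx F) x0 i 0 @[t --> \oo] --> (0 : R).

Lemma qf_shift p (F P : 'M[R]_p) x : sym P ->
  qf P (F *m x) = qf P x + qf (lyap 1 (F - 1%:M) P) x.
Proof.
move=> sP; rewrite qf_lyap // mulmxBl mul1mx mul1r addrA -qfD //.
by rewrite addrC subrK.
Qed.

(** As in continuous time, with [qf_shift] giving monotonicity along the iterates. *)
Lemma dt_real_stableP p (F : 'M[R]_p) : dt_real_stable F -> stable 1 (F - 1%:M).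
Proof.
move=> sF P sP pL x0; rewrite -oppr_le0 -qfNm; have sN := symN sP.
have cV := qf_cvg0 eventually_filter (- P) (sF x0).
have V0 t : qf (- P) x0 <= qf (- P) (iter t (mulmx F) x0).
  elim: t => [//|t IH]; rewrite iterS qf_shift // (le_trans IH) // lerDl linearN /=.
  exact: pL.
rewrite -(cvg_lim _ cV) //; apply: limr_ge; first by apply/cvg_ex; exists 0.
exact: nearW.
Qed.

Variables (n m : nat) (a : 'M[R]_n) (b : 'M[R]_(n, m)) (q : 'M[R]_n) (r : 'M[R]_m).
Variable P : 'M[R]_n.
Hypotheses (sq : sym q) (pq : pd q) (sr : sym r) (pr : pd r).
Hypotheses (sP : sym P) (pP : pd P) (ricP : ric 1 (a - 1%:M) b q r P = 0).
Let K := gain 1 (a - 1%:M) b r P.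
Let S := ricS 1 b r P.

Section Trajectory.
Variables (x : nat -> 'cV[R]_n) (u : nat -> 'cV[R]_m).
Hypothesis xS : forall t, x t.+1 = a *m x t + b *m u t.

Let c t := qf q (x t) + qf r (u t).
Let e t := qf S (u t - K *m x t).
Let V t := qf P (x t).

Let c_ge0 t : 0 <= c t.
Proof. by rewrite addr_ge0 //; apply: pd_psd. Qed.

Let pS : pd S.
Proof. by apply: ricS_pd => //; exact: pd_psd. Qed.

Let e_ge0 t : 0 <= e t.
Proof. exact: pd_psd. Qed.

Let V_ge0 t : 0 <= V t.
Proof. exact: pd_psd. Qed.

Let V_step t : c t + V t.+1 = V t + e t.
Proof.
have := complete_square (a - 1%:M) b q ler01 sr pr (x t) (u t) sP (pd_psd pP).
rewrite ricP qf0m add0r -/K -/S -/(e t) => <-.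
rewrite /V xS /c mul1r.
(* One step is put in incremental form, the shape treated by [complete_square] at [h = 1]. *)
have -> : a *m x t + b *m u t = x t + ((a - 1%:M) *m x t + b *m u t).
  by rewrite mulmxBl mul1mx addrA [x t + _]addrC subrK.
rewrite (qfD (x t)) //; ring.
Qed.

Let energy N : \sum_(0 <= t < N) c t + V N = V 0 + \sum_(0 <= t < N) e t.
Proof.
elim: N => [|N IH]; first by rewrite !big_geq // addr0 add0r.
by rewrite !big_nat_recr //= -addrA V_step [RHS]addrA -IH addrA.
Qed.

Let J := (\sum_(0 <= t <oo) (c t)%:E)%E.

Let sum_c_le N : ((\sum_(0 <= t < N) c t)%:E <= J)%E.
Proof.
rewrite -sumEFin; apply: nneseries_lim_ge => k _ _; by rewrite lee_fin.
Qed.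

Let V_small N (eps : R) : (J < +oo)%E -> 0 < eps -> exists2 t, (N <= t)%N & V t < eps.
Proof.
move=> Jy eps0; apply: contrapT => H.
have VN t : (N <= t)%N -> eps <= V t by move=> Nt; rewrite leNgt; apply/negP => ?; apply: H; exists t.
have [d d0 Hd] := pd_coercive sq pq; have [g g0 Hg] := qf_bound P.
set delta := d / g * eps.
have delta0 : 0 < delta by rewrite mulr_gt0 // divr_gt0.
have cd t : (N <= t)%N -> delta <= c t.
  move=> Nt; rewrite /c.
  have H1 : V t <= g * sqn (x t) := le_trans (ler_norm _) (Hg (x t)).
  apply: (@le_trans _ _ (qf q (x t))); last by rewrite lerDl; apply: pd_psd.
  apply: le_trans (Hd (x t)).
  rewrite /delta mulrAC ler_pdivrMr // -mulrA ler_pM2l // mulrC.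
  exact: le_trans (VN t Nt) _.
(* Partial sums grow at least linearly beyond [N], so finitely many terms exceed a finite [J]. *)
have sumc k : delta *+ k <= \sum_(0 <= t < N + k) c t.
  elim: k => [|k IH]; first by rewrite mulr0n sumr_ge0.
  by rewrite addnS big_nat_recr //= mulrSr lerD // cd // leq_addr.
have J0 : (0 <= J)%E by apply: nneseries_ge0 => t _ _; rewrite lee_fin.
have [j jE] : exists j, J = j%:E.
  by exists (fine J); rewrite fineK // ge0_fin_numE.
have jd : 0 <= j / delta by rewrite divr_ge0 ?(ltW delta0) // -lee_fin -jE.
have := sum_c_le (N + Num.bound (j / delta)); rewrite jE lee_fin.
move=> /(le_trans (sumc _)); rewrite leNgt => /negP; apply.
by rewrite -mulr_natl -ltr_pdivrMr // archi_boundP.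
Qed.

(** At a late time [t] with [V t < eps], the cost so far plus [V t] equals the initial value plus a
    sum of [e] that contains the first [N] terms. *)
Lemma dt_cost_lower N : ((qf P (x 0) + \sum_(0 <= t < N) e t)%:E <= J)%E.
Proof.
have [Jy|] := ltP J +oo%E; last by rewrite leye_eq => /eqP ->; exact: leey.
apply/lee_addgt0Pr => eps eps0.
have [t Nt Vt] := V_small N Jy eps0.
apply: (@le_trans _ _ (\sum_(0 <= s < t) c s + V t)%:E).
  rewrite energy lee_fin lerD2l (big_cat_nat (leq0n N) Nt) //= lerDl.
  by apply: sumr_ge0.
by rewrite EFinD leeD // lee_fin ltW.
Qed.

Lemma dt_cost_ge : ((qf P (x 0))%:E <= J)%E.
Proof. by have := dt_cost_lower 0; rewrite big_geq // addr0. Qed.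

Lemma dt_cost_eq : J = (qf P (x 0))%:E -> forall t, u t = K *m x t.
Proof.
move=> JE t; have := dt_cost_lower t.+1; rewrite JE lee_fin gerDl big_nat_recr //=.
have se : 0 <= \sum_(0 <= s < t) e s by apply: sumr_ge0.
move=> Ht; have et : e t <= 0 by lra.
apply/eqP; rewrite -subr_eq0; apply/negPn/negP => /pS.
by rewrite -/(e t) ltNge et.
Qed.

Hypothesis uK : forall t, u t = K *m x t.

Let e0 t : e t = 0.
Proof. by rewrite /e uK subrr qfx0. Qed.

Lemma dt_cost_feedback : J = (qf P (x 0))%:E.
Proof.
apply/eqP; rewrite eq_le dt_cost_ge andbT.
apply: lime_le; first by apply: is_cvg_nneseries => t _ _; rewrite lee_fin.
apply: nearW => N; rewrite sumEFin lee_fin.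
have se : \sum_(0 <= t < N) e t = 0 by apply: big1 => t _; exact: e0.
have := energy N; rewrite se addr0.
by rewrite -/(V 0) => <-; rewrite lerDl.
Qed.

Lemma dt_feedback_stable i : x t i 0 @[t --> \oo] --> (0 : R).
Proof.
move: i; apply: (pd_cvg0 _ sP pP); apply/cvgr0Pnorm_lt => eps eps0.
have Jy : (J < +oo)%E by rewrite dt_cost_feedback ltry.
have [T _ VT] := V_small 0 Jy eps0.
near=> t; have Tt : (T <= t)%N by near: t; exact: nbhs_infty_ge.
rewrite ger0_norm ?(pd_psd pP) //; apply: le_lt_trans VT.
rewrite -/(V t) -(subnKC Tt); elim: (t - T)%N => [|k IH]; first by rewrite addn0.
rewrite addnS; apply: le_trans IH.
by have := V_step (T + k); rewrite e0 addr0 => <-; rewrite lerDr.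
Unshelve. all: by end_near. Qed.

End Trajectory.

End DiscreteTime.

(** * Bimatrices as real matrices *)

Section RealForm.
Variable R : realType.
Local Open Scope classical_set_scope.
Local Notation C := R[i].
Local Notation Re := (@complex.Re R).
Local Notation Im := (@complex.Im R).

Definition mxRe p q (A : 'M[C]_(p, q)) : 'M[R]_(p, q) := map_mx Re A.
Definition mxIm p q (A : 'M[C]_(p, q)) : 'M[R]_(p, q) := map_mx Im A.

Lemma ReD (z w : C) : Re (z + w) = Re z + Re w. Proof. by case: z; case: w. Qed.
Lemma ImD (z w : C) : Im (z + w) = Im z + Im w. Proof. by case: z; case: w. Qed.
Lemma ReN (z : C) : Re (- z) = - Re z. Proof. by case: z. Qed.
Lemma ImN (z : C) : Im (- z) = - Im z. Proof. by case: z. Qed.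
Lemma ReM (z w : C) : Re (z * w) = Re z * Re w - Im z * Im w.
Proof. by case: z; case: w. Qed.
Lemma ImM (z w : C) : Im (z * w) = Im z * Re w + Re z * Im w.
Proof. by case: z => a b; case: w => c d /=; rewrite addrC. Qed.

Lemma Re_sum I (s : seq I) (f : I -> C) : Re (\sum_(i <- s) f i) = \sum_(i <- s) Re (f i).
Proof. exact: (big_morph Re ReD). Qed.
Lemma Im_sum I (s : seq I) (f : I -> C) : Im (\sum_(i <- s) f i) = \sum_(i <- s) Im (f i).
Proof. exact: (big_morph Im ImD). Qed.

Lemma mxReD p q (A B : 'M[C]_(p, q)) : mxRe (A + B) = mxRe A + mxRe B.
Proof. by apply/matrixP => i j; rewrite !mxE ReD. Qed.
Lemma mxImD p q (A B : 'M[C]_(p, q)) : mxIm (A + B) = mxIm A + mxIm B.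
Proof. by apply/matrixP => i j; rewrite !mxE ImD. Qed.
Lemma mxRe_mul p q r (A : 'M[C]_(p, q)) (B : 'M[C]_(q, r)) :
  mxRe (A *m B) = mxRe A *m mxRe B - mxIm A *m mxIm B.
Proof.
apply/matrixP => i j; rewrite !mxE Re_sum -sumrB; apply: eq_bigr => k _.
by rewrite ReM !mxE.
Qed.
Lemma mxIm_mul p q r (A : 'M[C]_(p, q)) (B : 'M[C]_(q, r)) :
  mxIm (A *m B) = mxIm A *m mxRe B + mxRe A *m mxIm B.
Proof.
apply/matrixP => i j; rewrite !mxE Im_sum -big_split; apply: eq_bigr => k _.
by rewrite ImM !mxE.
Qed.
Lemma mxRe_cmx p q (A : 'M[C]_(p, q)) : mxRe (cmx A) = mxRe A.
Proof. by apply/matrixP => i j; rewrite !mxE; case: (A i j). Qed.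
Lemma mxIm_cmx p q (A : 'M[C]_(p, q)) : mxIm (cmx A) = - mxIm A.
Proof. by apply/matrixP => i j; rewrite !mxE; case: (A i j). Qed.
Lemma mxRe_tr p q (A : 'M[C]_(p, q)) : mxRe A^T = (mxRe A)^T.
Proof. by apply/matrixP => i j; rewrite !mxE. Qed.
Lemma mxIm_tr p q (A : 'M[C]_(p, q)) : mxIm A^T = (mxIm A)^T.
Proof. by apply/matrixP => i j; rewrite !mxE. Qed.
Lemma mxRe_Im_inj p q (A B : 'M[C]_(p, q)) : mxRe A = mxRe B -> mxIm A = mxIm B -> A = B.
Proof.
move=> /matrixP hR /matrixP hI; apply/matrixP => i j.
by have := hI i j; have := hR i j; rewrite !mxE; case: (A i j) (B i j) => ? ? [? ?] /= -> ->.
Qed.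

Definition realvec p (x : 'cV[C]_p) : 'cV[R]_(p + p) := col_mx (mxRe x) (mxIm x).
Definition cplxvec p (y : 'cV[R]_(p + p)) : 'cV[C]_p :=
  \col_i (usubmx y i 0 +i* dsubmx y i 0)%C.

(* [{A_1, A_2}_\circ]: the matrix of the real-linear map [bapp A] in the
   coordinates [realvec]. *)
Definition realmat p q (A : bimx R p q) : 'M[R]_(p + p, q + q) :=
  block_mx (mxRe (bm1 A) + mxRe (bm2 A)) (- (mxIm (bm1 A) + mxIm (bm2 A)))
           (mxIm (bm1 A) - mxIm (bm2 A)) (mxRe (bm1 A) - mxRe (bm2 A)).
(** Splits a real-linear map into its complex-linear part and the conjugate of its antilinear part;
    every real matrix of doubled size is thus a bimatrix. *)
Definition cplxmat p q (M : 'M[R]_(p + p, q + q)) : bimx R p q :=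
  Bimx (\matrix_(i, j) (((ulsubmx M i j + drsubmx M i j) / 2) +i*
                        ((dlsubmx M i j - ursubmx M i j) / 2))%C)
       (\matrix_(i, j) (((ulsubmx M i j - drsubmx M i j) / 2) +i*
                        (- (dlsubmx M i j + ursubmx M i j) / 2))%C).

Lemma cplxvecK p : cancel (@cplxvec p) (@realvec p).
Proof.
move=> y; rewrite -[RHS]vsubmxK /realvec; congr col_mx.
  by apply/matrixP => i j; rewrite (ord1 j) [LHS]mxE [cplxvec _ _ _]mxE.
by apply/matrixP => i j; rewrite (ord1 j) [LHS]mxE [cplxvec _ _ _]mxE.
Qed.

Lemma realvecK p : cancel (@realvec p) (@cplxvec p).
Proof.
move=> x; apply/matrixP => i j; rewrite (ord1 j) mxE /realvec col_mxKu col_mxKd !mxE.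
by case: (x i 0).
Qed.

Lemma realvec_inj p : injective (@realvec p).
Proof. exact: can_inj (@realvecK p). Qed.

Lemma cplxmatK p q : cancel (@cplxmat p q) (@realmat p q).
Proof.
move=> M; rewrite -[RHS]submxK /realmat /cplxmat /=.
by congr block_mx; apply/matrixP => i j; rewrite !mxE /=; field.
Qed.

Lemma realmatK p q : cancel (@realmat p q) (@cplxmat p q).
Proof.
case=> A1 A2; rewrite /realmat /cplxmat /= block_mxKul block_mxKur block_mxKdl block_mxKdr.
by congr Bimx; apply: mxRe_Im_inj; apply/matrixP => i j; rewrite !mxE /=; field.
Qed.

Lemma realvec_bapp p q (A : bimx R p q) x : realvec (bapp A x) = realmat A *m realvec x.
Proof.
rewrite /realvec /realmat mul_block_col /bapp.
rewrite mxReD mxImD !mxRe_mul !mxIm_mul !mxRe_cmx !mxIm_cmx.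
rewrite !(mulmxDl, mulNmx, mulmxN); congr col_mx.
  by rewrite opprK opprD addrACA.
by rewrite addrACA.
Qed.

Lemma realvecD p (x y : 'cV[C]_p) : realvec (x + y) = realvec x + realvec y.
Proof. by rewrite /realvec mxReD mxImD add_col_mx. Qed.

(** Every real vector is some [realvec x], so the action on these determines the matrix. *)
Lemma realmatP p q (A : bimx R p q) (M : 'M[R]_(p + p, q + q)) :
  (forall x, realvec (bapp A x) = M *m realvec x) -> realmat A = M.
Proof.
move=> H; apply/matrixP => i j; rewrite -!bf_delta /bf -!mulmxA.
by rewrite -[delta_mx j 0]cplxvecK -H realvec_bapp.
Qed.

Lemma bimx_eqP p q (A B : bimx R p q) : bimx_eq A B <-> realmat A = realmat B.
Proof.
split=> [H|H x]; last by apply: realvec_inj; rewrite !realvec_bapp H.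
by apply: realmatP => x; rewrite H realvec_bapp.
Qed.

Lemma cmxD p q (A B : 'M[C]_(p, q)) : cmx (A + B) = cmx A + cmx B.
Proof. exact: map_mxD. Qed.
Lemma cmxM p q r (A : 'M[C]_(p, q)) (B : 'M[C]_(q, r)) : cmx (A *m B) = cmx A *m cmx B.
Proof. exact: map_mxM. Qed.
Lemma cmxK p q : involutive (@cmx R p q).
Proof. by move=> A; apply/matrixP => i j; rewrite !mxE conjcK. Qed.

Lemma bapp_bmul p q r (A : bimx R p q) (B : bimx R q r) x :
  bapp (bmul A B) x = bapp A (bapp B x).
Proof.
rewrite /bapp /bmul /= !cmxD !cmxM !cmxK !mulmxDl !mulmxDr !mulmxA.
by rewrite addrACA; congr (_ + _); rewrite addrC.
Qed.

Lemma realmat_mul p q r (A : bimx R p q) (B : bimx R q r) :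
  realmat (bmul A B) = realmat A *m realmat B.
Proof. by apply: realmatP => x; rewrite bapp_bmul !realvec_bapp mulmxA. Qed.

Lemma realmatD p q (A B : bimx R p q) : realmat (badd A B) = realmat A + realmat B.
Proof.
apply: realmatP => x; rewrite mulmxDl -!realvec_bapp -realvecD; congr realvec.
by rewrite /bapp /= cmxD !mulmxDl addrACA.
Qed.

Lemma realmatN p q (A : bimx R p q) : realmat (bopp A) = - realmat A.
Proof.
rewrite /realmat /bopp opp_block_mx /=.
by congr block_mx; apply/matrixP => i j; rewrite !mxE ?ReN ?ImN; ring.
Qed.

Lemma realmatB p q (A B : bimx R p q) : realmat (bsub A B) = realmat A - realmat B.
Proof. by rewrite realmatD realmatN. Qed.

Lemma realmat_id p : realmat (bid R p) = 1%:M.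
Proof.
apply: realmatP => x; rewrite mul1mx; congr realvec.
by rewrite /bapp /bid /= mul1mx /cmx map_mx0 mul0mx addr0.
Qed.

Lemma realmat_H p q (A : bimx R p q) : realmat (bH A) = (realmat A)^T.
Proof.
rewrite /realmat tr_block_mx /bH /hmx /= !mxRe_tr !mxIm_tr mxRe_cmx mxIm_cmx.
by congr block_mx; apply/matrixP => i j; rewrite !mxE; ring.
Qed.

Lemma bqfE p (P : bimx R p p) x : bqf P x = qf (realmat P) (realvec x).
Proof.
rewrite /bqf /qf /bf -mulmxA -realvec_bapp /realvec tr_col_mx mul_row_col.
have -> : complex.Re ((hmx x *m bapp P x) 0 0) = mxRe (hmx x *m bapp P x) 0 0 by rewrite [RHS]mxE.
by rewrite mxRe_mul /hmx mxRe_tr mxIm_tr mxRe_cmx mxIm_cmx linearN /= mulNmx opprK.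
Qed.

Lemma realvec0 p : realvec (0 : 'cV[C]_p) = 0.
Proof. by rewrite /realvec /mxRe /mxIm -[RHS]col_mx0; congr col_mx; apply/matrixP => i j; rewrite !mxE. Qed.

(** The two symmetry conditions together say [bH P = P], which [realmat] turns into symmetry. *)
Lemma bposP p (P : bimx R p p) : bpos P <-> sym (realmat P) /\ pd (realmat P).
Proof.
split=> [[P1 P2 pP]|[sP pP]].
  split; first by rewrite /sym -realmat_H; congr realmat; case: P P1 P2 {pP} => ? ? /= {2}-> {2}->.
  move=> y y0; rewrite -[y]cplxvecK -bqfE; apply: pP.
  by apply: contra_neq y0 => y0; rewrite -[y]cplxvecK y0 realvec0.
have : bH P = P by apply: (can_inj (@realmatK p p)); rewrite realmat_H.
case: P sP pP => P1 P2 sP pP [E1 E2]; split=> //= x x0.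
rewrite bqfE; apply: pP; apply: contra_neq x0 => x0.
by apply: realvec_inj; rewrite x0 realvec0.
Qed.

(** The real inverse pulled back by [cplxmat] shows that an inverse bimatrix exists, so the chosen
    one is an inverse; uniqueness of matrix inverses identifies it. *)
Lemma realmat_inv p (A : bimx R p p) : realmat A \in unitmx -> realmat (binv A) = invmx (realmat A).
Proof.
move=> uA; have : is_binv A (binv A).
  apply: epsilon_spec; exists (cplxmat (invmx (realmat A))); split; apply/bimx_eqP.
    by rewrite realmat_mul cplxmatK mulmxV // realmat_id.
  by rewrite realmat_mul cplxmatK mulVmx // realmat_id.
move=> [/bimx_eqP + _]; rewrite realmat_mul realmat_id => E.
by rewrite -[LHS](mulKmx uA) E mulmx1.
Qed.

End RealForm.

(** * Transfer of the control problems *)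

Section Transfer.
Variable R : realType.
Local Open Scope classical_set_scope.
Local Notation C := R[i].

Lemma lyap_shift p (a P : 'M[R]_p) : lyap 1 (a - 1%:M) P = a^T *m P *m a - P.
Proof.
rewrite /lyap scale1r linearB /= trmx1 !(mulmxBl, mulmxBr, mul1mx, mulmx1).
by apply/matrixP => i j; rewrite !(addmx_entry, oppmx_entry); ring.
Qed.

Lemma oppr_eq_sub (W : zmodType) (x y z : W) : - x = y - z <-> y + x - z = 0.
Proof.
split=> [E|/eqP]; first by rewrite addrAC -E addNr.
by rewrite addrAC addr_eq0 => /eqP ->.
Qed.

Lemma ct_gainE n m (A : bimx R n n) (B : bimx R n m) (Rw : bimx R m m) (P : bimx R n n) :
  bpos Rw ->
  realmat (ct_gain B Rw P) = gain 0 (realmat A) (realmat B) (realmat Rw) (realmat P).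
Proof.
move=> /bposP[_ pr]; rewrite /ct_gain realmatN !realmat_mul realmat_inv ?realmat_H ?pd_unitmx //.
by rewrite /gain /ricN /ricS !scale0r !addr0 mulmx1 !mulmxA.
Qed.

Lemma ct_riccatiP n m (A : bimx R n n) (B : bimx R n m) (Q : bimx R n n)
    (Rw : bimx R m m) (P : bimx R n n) : bpos Rw -> bpos P ->
  ct_riccati A B Q Rw P <->
  ric 0 (realmat A) (realmat B) (realmat Q) (realmat Rw) (realmat P) = 0.
Proof.
move=> /bposP[_ pr] /bposP[sP _].
rewrite /ct_riccati bimx_eqP realmatN realmatB realmatD !realmat_mul.
rewrite realmat_inv ?realmat_H ?pd_unitmx //.
rewrite /ric /lyap /ricN /ricS !scale0r !addr0 mulmx1 trmx_mul trmxK sP.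
by rewrite !mulmxA; exact: oppr_eq_sub.
Qed.

Lemma dt_SE n m (B : bimx R n m) (Rw : bimx R m m) (P : bimx R n n) :
  realmat (dt_S B Rw P) = ricS 1 (realmat B) (realmat Rw) (realmat P).
Proof. by rewrite /dt_S /ricS realmatD !realmat_mul realmat_H scale1r. Qed.

Lemma dt_S_unit n m (B : bimx R n m) (Rw : bimx R m m) (P : bimx R n n) :
  bpos Rw -> bpos P -> realmat (dt_S B Rw P) \in unitmx.
Proof.
move=> /bposP[sr pr] /bposP[sP pP]; rewrite dt_SE pd_unitmx //.
by apply: ricS_pd => //; exact: pd_psd.
Qed.

Lemma dt_gainE n m (A : bimx R n n) (B : bimx R n m) (Rw : bimx R m m) (P : bimx R n n) :
  bpos Rw -> bpos P ->
  realmat (dt_gain A B Rw P) = gain 1 (realmat A - 1%:M) (realmat B) (realmat Rw) (realmat P).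
Proof.
move=> pr pP; rewrite /dt_gain realmatN !realmat_mul realmat_inv ?dt_S_unit // realmat_H dt_SE.
by rewrite /gain /ricN scale1r [1%:M + _]addrC subrK !mulmxA.
Qed.

Lemma dt_riccatiP n m (A : bimx R n n) (B : bimx R n m) (Q : bimx R n n)
    (Rw : bimx R m m) (P : bimx R n n) : bpos Rw -> bpos P ->
  dt_riccati A B Q Rw P <->
  ric 1 (realmat A - 1%:M) (realmat B) (realmat Q) (realmat Rw) (realmat P) = 0.
Proof.
move=> pr pP; have /bposP[sP _] := pP.
rewrite /dt_riccati bimx_eqP realmatN !realmatB !realmat_mul.
rewrite realmat_inv ?dt_S_unit // !realmat_H dt_SE.
rewrite /ric lyap_shift /ricN scale1r [1%:M + _]addrC subrK !trmx_mul trmxK sP.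
by rewrite !mulmxA; exact: oppr_eq_sub.
Qed.

Lemma realvec_l p (x : 'cV[C]_p) i : realvec x (lshift p i) 0 = complex.Re (x i 0).
Proof. by rewrite col_mxEu mxE. Qed.

Lemma realvec_r p (x : 'cV[C]_p) i : realvec x (rshift p i) 0 = complex.Im (x i 0).
Proof. by rewrite col_mxEd mxE. Qed.

(** Abstracting over the predicate lets one lemma transfer integrability, integral equations and
    limits. *)
Lemma realvec_coordP p (P : ('cV[C]_p -> R) -> Prop) :
  (forall i, P (fun x => realvec x i 0)) <->
  (forall i, P (fun x => complex.Re (x i 0)) /\ P (fun x => complex.Im (x i 0))).
Proof.
have El i : (fun x : 'cV[C]_p => realvec x (lshift p i) 0) = fun x => complex.Re (x i 0).
  by apply/funext => x; exact: realvec_l.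
have Er i : (fun x : 'cV[C]_p => realvec x (rshift p i) 0) = fun x => complex.Im (x i 0).
  by apply/funext => x; exact: realvec_r.
split=> H i; first by rewrite -El -Er.
case: (splitP i) => j ij.
  by have -> : i = lshift p j by [apply: val_inj]; rewrite El; case: (H j).
by have -> : i = rshift p j by [apply: val_inj]; rewrite Er; case: (H j).
Qed.

Lemma ct_integral_eqP p (x0 : 'cV[C]_p) x v : ct_integral_eq x0 x v <->
  vprim (realvec x0) (fun t => realvec (x t)) (fun t => realvec (v t)).
Proof.
rewrite /vprim.
rewrite (realvec_coordP (fun f => prim (f x0) (fun t => f (x t)) (fun t => f (v t)))).
by split=> H i; [have [] := H i|have [[? ?] [? ?]] := H i].
Qed.

Lemma ct_asym_stableP p (F : bimx R p p) : ct_asym_stable F <-> ct_real_stable (realmat F).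
Proof.
split=> [H y0 y py|H x0 x /ct_integral_eqP px].
  have px : ct_integral_eq (cplxvec y0) (fun t => cplxvec (y t)) (fun t => bapp F (cplxvec (y t))).
    apply/ct_integral_eqP; rewrite cplxvecK.
    have -> : (fun t => realvec (cplxvec (y t))) = y by apply/funext => t; rewrite cplxvecK.
    have -> // : (fun t => realvec (bapp F (cplxvec (y t)))) = (fun t => realmat F *m y t).
    by apply/funext => t; rewrite realvec_bapp cplxvecK.
  have := H _ _ px.
  rewrite -(realvec_coordP (fun f => f (cplxvec (y t)) @[t --> +oo] --> (0 : R))) => Hy i.
  have := Hy i.
  by have -> : (fun t => realvec (cplxvec (y t)) i 0) = (fun t => y t i 0)
    by apply/funext => t; rewrite cplxvecK.
apply/(realvec_coordP (fun f => f (x t) @[t --> +oo] --> (0 : R))).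
apply: (H (realvec x0)).
have -> // : (fun t => realmat F *m realvec (x t)) = (fun t => realvec (bapp F (x t))).
by apply/funext => t; rewrite realvec_bapp.
Qed.

Lemma realvec_iter p (F : bimx R p p) t x :
  realvec (iter t (bapp F) x) = iter t (mulmx (realmat F)) (realvec x).
Proof. by elim: t => //= t IH; rewrite realvec_bapp IH. Qed.

Lemma dt_asym_stableP p (F : bimx R p p) : dt_asym_stable F <-> dt_real_stable (realmat F).
Proof.
split=> [H y0|H x0].
  have := H (cplxvec y0).
  rewrite -(realvec_coordP (fun f => f (iter t (bapp F) (cplxvec y0)) @[t --> \oo] --> (0 : R))).
  move=> Hy i; have := Hy i.
  by have -> : (fun t => realvec (iter t (bapp F) (cplxvec y0)) i 0) =
    (fun t => iter t (mulmx (realmat F)) y0 i 0)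
    by apply/funext => t; rewrite realvec_iter cplxvecK.
apply/(realvec_coordP (fun f => f (iter t (bapp F) x0) @[t --> \oo] --> (0 : R))) => i.
have := H (realvec x0) i.
by have -> : (fun t => realvec (iter t (bapp F) x0) i 0) =
    (fun t => iter t (mulmx (realmat F)) (realvec x0) i 0)
    by apply/funext => t; rewrite realvec_iter.
Qed.

Lemma ct_admissibleP n m (A : bimx R n n) (B : bimx R n m) x0 x u :
  ct_admissible A B x0 x u <->
  (forall j, loc_integrable (fun t => realvec (u t) j 0)) /\
  vprim (realvec x0) (fun t => realvec (x t))
    (fun t => realmat A *m realvec (x t) + realmat B *m realvec (u t)).
Proof.
rewrite /ct_admissible ct_integral_eqP.
rewrite -(realvec_coordP (fun f => loc_integrable (fun t => f (u t)))).
have -> // : (fun t => realvec (bapp A (x t) + bapp B (u t))) =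
  (fun t => realmat A *m realvec (x t) + realmat B *m realvec (u t)).
by apply/funext => t; rewrite realvecD !realvec_bapp.
Qed.

Lemma ct_costE n m (Q : bimx R n n) (Rw : bimx R m m) x u : ct_cost Q Rw x u =
  (\int[@lebesgue_measure R]_(t in `[0%R, +oo[)
     (qf (realmat Q) (realvec (x t)) + qf (realmat Rw) (realvec (u t)))%:E)%E.
Proof. by apply: eq_integral => t _; rewrite !bqfE. Qed.

Lemma dt_costE n m (Q : bimx R n n) (Rw : bimx R m m) x u : dt_cost Q Rw x u =
  (\sum_(0 <= t <oo)
     (qf (realmat Q) (realvec (x t)) + qf (realmat Rw) (realvec (u t)))%:E)%E.
Proof. by apply: eq_eseriesr => t _; rewrite !bqfE. Qed.

Lemma prim_loc_integrable (x0 : R) x v : prim x0 x v -> loc_integrable x.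
Proof.
move=> px t t0; apply: continuous_compact_integrable; first exact: segment_compact.
exact: prim_continuous px t0.
Qed.

(** Makes feedback controls admissible: each coordinate of [K *m x] is again absolutely
    continuous. *)
Lemma vprim_loc_integrable p q (K : 'M[R]_(q, p)) x0 x v : vprim x0 x v ->
  forall j, loc_integrable (fun t => (K *m x t) j 0).
Proof.
move=> px j.
have -> : (fun t => (K *m x t) j 0) = (fun t => \sum_i K j i * x t i 0).
  by apply/funext => t; rewrite mxE.
apply: (@prim_loc_integrable (\sum_i K j i * x0 i 0) _ (fun t => \sum_i K j i * v t i 0)).
by apply: prim_sum => i; apply: primZ.
Qed.

End Transfer.

(** * Return from real matrices to bimatrices on both time axes *)

Theorem theorem4 (R : realType) (n m : nat)
    (A : bimx R n n) (B : bimx R n m) (Q : bimx R n n) (Rw : bimx R m m) :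
  bpos Q -> bpos Rw ->
  (* continuous time, t in R^+ *)
  (ct_stabilizable A B ->
   exists P : bimx R n n,
     [/\ bpos P, ct_riccati A B Q Rw P,
         (forall P' : bimx R n n, bpos P' -> ct_riccati A B Q Rw P' ->
            bimx_eq P' P),
         ct_asym_stable (badd A (bmul B (ct_gain B Rw P))) &
         forall x0 : 'cV[R[i]]_n,
           exists xs : R -> 'cV[R[i]]_n,
             [/\ ct_admissible A B x0 xs
                   (fun t => bapp (ct_gain B Rw P) (xs t)),
                 ct_cost Q Rw xs (fun t => bapp (ct_gain B Rw P) (xs t))
                   = (bqf P x0)%:E &
                 forall (x : R -> 'cV[R[i]]_n) (u : R -> 'cV[R[i]]_m),
                   ct_admissible A B x0 x u ->
                   ((bqf P x0)%:E <= ct_cost Q Rw x u)%E /\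
                   (ct_cost Q Rw x u = (bqf P x0)%:E ->
                    {ae @lebesgue_measure R, forall t : R,
                        (0 <= t)%R -> u t = bapp (ct_gain B Rw P) (x t)})]])
  /\
  (* discrete time, t in Z^+ *)
  (dt_stabilizable A B ->
   exists P : bimx R n n,
     [/\ bpos P, dt_riccati A B Q Rw P,
         (forall P' : bimx R n n, bpos P' -> dt_riccati A B Q Rw P' ->
            bimx_eq P' P),
         dt_asym_stable (badd A (bmul B (dt_gain A B Rw P))) &
         forall x0 : 'cV[R[i]]_n,
           let ustar := fun t : nat =>
             bapp (dt_gain A B Rw P)
               (iter t (bapp (badd A (bmul B (dt_gain A B Rw P)))) x0) in
           [/\ (forall t : nat, ustar t = bapp (dt_gain A B Rw P) (dt_traj A B x0 ustar t)),
               dt_cost Q Rw (dt_traj A B x0 ustar) ustar = (bqf P x0)%:E &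
               forall u : nat -> 'cV[R[i]]_m,
                 ((bqf P x0)%:E <= dt_cost Q Rw (dt_traj A B x0 u) u)%E /\
                 (dt_cost Q Rw (dt_traj A B x0 u) u = (bqf P x0)%:E ->
                  forall t : nat, u t = bapp (dt_gain A B Rw P) (dt_traj A B x0 u t))]]).
Proof.
move=> pQ pRw; have /bposP[sq pq] := pQ; have /bposP[sr pr] := pRw.
split=> [[K0 /ct_asym_stableP]|[K0 /dt_asym_stableP]]; rewrite realmatD realmat_mul.
- move=> /ct_real_stableP stK.
  have [p [sp pp ricp _]] := riccati_exists (lexx 0) sq pq sr pr stK.
  have PE : realmat (cplxmat p) = p := cplxmatK p.
  have pP : bpos (cplxmat p) by apply/bposP; rewrite PE.
  have gE : realmat (ct_gain B Rw (cplxmat p)) =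
      gain 0 (realmat A) (realmat B) (realmat Rw) p by rewrite (ct_gainE A) // PE.
  exists (cplxmat p); split=> //.
  + by apply/ct_riccatiP => //; rewrite PE.
  + move=> P' pP' /(ct_riccatiP _ _ _ pRw pP') ricP'; have /bposP[sP' pdP'] := pP'.
    apply/bimx_eqP; rewrite PE.
    exact: (riccati_unique (lexx 0) sq pq sr pr sp pp ricp sP' pdP' ricP').
  (* A closed-loop solution is a trajectory of the open system under the control [gain *m x]. *)
  + apply/ct_asym_stableP; rewrite realmatD realmat_mul gE => x0 x px.
    apply: (ct_feedback_stable (u := fun t => gain 0 _ _ _ p *m x t)
      sq pq sr pr sp pp ricp (vprim_loc_integrable _ px)) => // i.
    by apply: prim_eqv (px i) _ => t; rewrite mulmxDl mulmxA.
  move=> x0.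
  (* The exponential flow of the closed loop supplies the optimal trajectory. *)
  pose F := realmat A + realmat B *m gain 0 (realmat A) (realmat B) (realmat Rw) p.
  pose y := ode_sol F (realvec x0); pose xs t := cplxvec (y t).
  have yE : (fun t => realvec (xs t)) = y by apply/funext => t; rewrite cplxvecK.
  have uE t : realvec (bapp (ct_gain B Rw (cplxmat p)) (xs t)) =
      gain 0 (realmat A) (realmat B) (realmat Rw) p *m realvec (xs t).
    by rewrite realvec_bapp gE.
  have adm : ct_admissible A B x0 xs (fun t => bapp (ct_gain B Rw (cplxmat p)) (xs t)).
    apply/ct_admissibleP; split=> [j|i].
      have -> : (fun t => realvec (bapp (ct_gain B Rw (cplxmat p)) (xs t)) j 0) =
          (fun t => (gain 0 (realmat A) (realmat B) (realmat Rw) p *m y t) j 0).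
        by apply/funext => t; rewrite uE cplxvecK.
      exact: (vprim_loc_integrable _ (vprim_exists F (realvec x0))).
    have -> : (fun t => realvec (xs t) i 0) = (fun t => y t i 0).
      by apply/funext => t; rewrite cplxvecK.
    apply: prim_eqv (vprim_exists F (realvec x0) i) _ => t.
    by rewrite uE cplxvecK mulmxDl mulmxA.
  exists xs; split=> //; first have /ct_admissibleP[iu px] := adm.
    by rewrite ct_costE bqfE PE (ct_cost_feedback sq pq sr pr sp pp ricp iu px uE).
  move=> x u /ct_admissibleP[iu px]; rewrite ct_costE bqfE PE; split.
    exact: (ct_cost_ge sq pq sr pr sp pp ricp iu px).
  move=> /(ct_cost_eq sq pq sr pr sp pp ricp iu px) H.
  apply: (filterS (Filter := ae_filter_ringOfSetsType (@lebesgue_measure R)) _ H) => t ut t0.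
  by apply: realvec_inj; rewrite realvec_bapp gE ut.
(* Regroups [(A + B K) - 1] as [(A - 1) + B K], the closed loop of the shifted system. *)
- move=> /dt_real_stableP; rewrite addrAC => stK.
  have [p [sp pp ricp _]] := riccati_exists ler01 sq pq sr pr stK.
  have PE : realmat (cplxmat p) = p := cplxmatK p.
  have pP : bpos (cplxmat p) by apply/bposP; rewrite PE.
  have gE : realmat (dt_gain A B Rw (cplxmat p)) =
      gain 1 (realmat A - 1%:M) (realmat B) (realmat Rw) p by rewrite dt_gainE // PE.
  exists (cplxmat p); split=> //.
  + by apply/dt_riccatiP => //; rewrite PE.
  + move=> P' pP' /(dt_riccatiP _ _ _ pRw pP') ricP'; have /bposP[sP' pdP'] := pP'.
    apply/bimx_eqP; rewrite PE.
    exact: (riccati_unique ler01 sq pq sr pr sp pp ricp sP' pdP' ricP').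
  + apply/dt_asym_stableP; rewrite realmatD realmat_mul gE => x0.
    apply: (dt_feedback_stable (u := fun t => gain 1 _ _ _ p *m iter t _ x0)
      sq pq sr pr sp pp ricp) => // t.
    by rewrite iterS mulmxDl mulmxA.
  move=> x0 ustar.
  (* The control is defined from closed-loop iterates; these are the trajectory it generates in the
     open system. *)
  have traj t : iter t (bapp (badd A (bmul B (dt_gain A B Rw (cplxmat p))))) x0 =
      dt_traj A B x0 ustar t.
    elim: t => [//|t IH]; rewrite iterS /= -IH; apply: realvec_inj.
    by rewrite realvecD !realvec_bapp realmatD realmat_mul mulmxDl mulmxA.
  have uE t : ustar t = bapp (dt_gain A B Rw (cplxmat p)) (dt_traj A B x0 ustar t).
    by rewrite -traj.
  have xS u t : realvec (dt_traj A B x0 u t.+1) =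
      realmat A *m realvec (dt_traj A B x0 u t) + realmat B *m realvec (u t).
    by rewrite /= realvecD !realvec_bapp.
  split=> //.
    rewrite dt_costE bqfE PE.
    apply: (dt_cost_feedback sq pq sr pr sp pp ricp (xS ustar)) => t.
    by rewrite {1}uE realvec_bapp gE.
  move=> u; rewrite dt_costE bqfE PE; split.
    exact: (dt_cost_ge sq pq sr pr sp pp ricp (xS u)).
  move=> /(dt_cost_eq sq pq sr pr sp pp ricp (xS u)) ut t.
  by apply: realvec_inj; rewrite realvec_bapp gE ut.
Qed.
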